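(* Let $k,r,n$ be integers with $n\ge k\ge 5$ and $3\le r\le \lfloor (k-1)/2\rfloor+1$, and let $\mathcal{H}=\{K_r\}\cup\mathcal{C}_{\ge k}$. If $n\ge \frac{k^2}{2}$, then $$\mathrm{ex}_{2\text{-conn}}(n,\mathcal{H})=e(G_2),$$ where $G_2=T(\lfloor (k-1)/2\rfloor,\,r-2)\vee I_{\,n-\lfloor (k-1)/2\rfloor}$.
   Context: Graphs are finite and simple; $e(G)$ is the number of edges of $G$. $\mathcal{C}_{\ge k}$ is the set of all cycles of length at least $k$. A graph is $\mathcal{H}$-free if it contains no member of $\mathcal{H}$ as a (not necessarily induced) subgraph. $\mathrm{ex}_{2\text{-conn}}(n,\mathcal{H})$ is the maximum number of edges in a 2-connected $n$-vertex $\mathcal{H}$-free graph. $T(m,s)$ is the balanced complete $s$-partite graph on $m$ vertices (Turán graph; $T(m,1)$ has no edges). $I_m$ is the graph with $m$ vertices and no edges. The join $F_1\vee F_2$ of vertex-disjoint graphs is obtained from $F_1\cup F_2$ by joining every vertex of $F_1$ to every vertex of $F_2$. *)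

(* Defs.v *)
From mathcomp Require Import all_boot.

Set Implicit Arguments.
Unset Strict Implicit.
Unset Printing Implicit Defensive.

Record sgraph := SGraph {
  vertex :> finType;
  adj : rel vertex;
  adj_sym : symmetric adj;
  adj_irrefl : irreflexive adj }.

Definition edge_set (G : sgraph) : {set {set G}} :=
  [set [set p.1; p.2] | p : G * G & adj p.1 p.2].

Definition num_edges (G : sgraph) : nat := #|edge_set G|.

Section Induced.
Variables (G : sgraph) (A : {set G}).

Definition induced_adj : rel {x : G | x \in A} :=
  fun x y => adj (val x) (val y).

Lemma induced_adj_sym : symmetric induced_adj.
Proof. by move=> x y; rewrite /induced_adj adj_sym. Qed.

Lemma induced_adj_irrefl : irreflexive induced_adj.
Proof. by move=> x; rewrite /induced_adj adj_irrefl. Qed.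

Definition induced : sgraph := SGraph induced_adj_sym induced_adj_irrefl.

End Induced.

Definition connected_graph (G : sgraph) : Prop :=
  0 < #|G| /\ forall x y : G, connect (@adj G) x y.

(* l-connectivity as in Diestel: more than l vertices, and no deletion of
   fewer than l vertices disconnects the graph. *)
Definition vertex_connected (l : nat) (G : sgraph) : Prop :=
  l < #|G| /\
  forall X : {set G}, #|X| < l -> connected_graph (induced (~: X)).

(* F is isomorphic to a (not necessarily induced) subgraph of G. *)
Definition contains (G F : sgraph) : Prop :=
  exists2 f : F -> G,
    injective f & forall x y : F, adj x y -> adj (f x) (f y).

Definition graph_family := sgraph -> Prop.

Definition graph_free (H : graph_family) (G : sgraph) : Prop :=
  forall F : sgraph, H F -> ~ contains G F.

Section Complete.
Variable r : nat.

Definition complete_adj : rel 'I_r := fun x y => x != y.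

Lemma complete_adj_sym : symmetric complete_adj.
Proof. by move=> x y; rewrite /complete_adj eq_sym. Qed.

Lemma complete_adj_irrefl : irreflexive complete_adj.
Proof. by move=> x; rewrite /complete_adj eqxx. Qed.

Definition complete_graph : sgraph :=
  SGraph complete_adj_sym complete_adj_irrefl.

End Complete.

Section Edgeless.
Variable m : nat.

Definition edgeless_adj : rel 'I_m := fun _ _ => false.

Lemma edgeless_adj_sym : symmetric edgeless_adj.
Proof. by []. Qed.

Lemma edgeless_adj_irrefl : irreflexive edgeless_adj.
Proof. by []. Qed.

Definition edgeless_graph : sgraph :=
  SGraph edgeless_adj_sym edgeless_adj_irrefl.

End Edgeless.

(* A cycle of length l only for 3 <= l; the test x != y makes the relation
   irreflexive also when l = 1. *)
Section Cycle.
Variable l : nat.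

Definition cycle_adj : rel 'I_l :=
  fun x y => (x != y) && ((y == x.+1 %% l :> nat) || (x == y.+1 %% l :> nat)).

Lemma cycle_adj_sym : symmetric cycle_adj.
Proof. by move=> x y; rewrite /cycle_adj eq_sym orbC. Qed.

Lemma cycle_adj_irrefl : irreflexive cycle_adj.
Proof. by move=> x; rewrite /cycle_adj eqxx. Qed.

Definition cycle_graph : sgraph := SGraph cycle_adj_sym cycle_adj_irrefl.

End Cycle.

Definition cycles_ge (k : nat) : graph_family :=
  fun F => exists l : nat, [/\ 3 <= l, k <= l & F = cycle_graph l].

Definition clique_or_long_cycle (r k : nat) : graph_family :=
  fun F => F = complete_graph r \/ cycles_ge k F.

(* For s > 0, the parts are the residue classes mod s in {0, ..., m-1}, whose
   sizes differ by at most one. *)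
Section Turan.
Variables m s : nat.

Definition turan_adj : rel 'I_m := fun x y => x %% s != y %% s.

Lemma turan_adj_sym : symmetric turan_adj.
Proof. by move=> x y; rewrite /turan_adj eq_sym. Qed.

Lemma turan_adj_irrefl : irreflexive turan_adj.
Proof. by move=> x; rewrite /turan_adj eqxx. Qed.

Definition turan_graph : sgraph := SGraph turan_adj_sym turan_adj_irrefl.

End Turan.

Section Join.
Variables F1 F2 : sgraph.

Definition join_adj : rel (F1 + F2)%type := fun u v =>
  match u, v with
  | inl x, inl y => adj x y
  | inr x, inr y => adj x y
  | _, _ => true
  end.

Lemma join_adj_sym : symmetric join_adj.
Proof. by move=> [x|x] [y|y] //=; rewrite adj_sym. Qed.

Lemma join_adj_irrefl : irreflexive join_adj.
Proof. by move=> [x|x] /=; rewrite adj_irrefl. Qed.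

Definition graph_join : sgraph := SGraph join_adj_sym join_adj_irrefl.

End Join.

(* "ex_{2-conn}(n, H) = m": the maximum is attained at m, so in particular the
   class of graphs over which it is taken is nonempty. *)
Definition is_ex_2conn (n : nat) (H : graph_family) (m : nat) : Prop :=
  let candidate (G : sgraph) :=
    [/\ #|G| = n, vertex_connected 2 G & graph_free H G] in
  (exists2 G : sgraph, candidate G & num_edges G = m) /\
  (forall G : sgraph, candidate G -> num_edges G <= m).

Definition G2 (k r n : nat) : sgraph :=
  graph_join (turan_graph ((k - 1) %/ 2) (r - 2))
             (edgeless_graph (n - (k - 1) %/ 2)).

(* Main.v *)
Require Import Defs.
From mathcomp Require Import all_boot zify.

Set Implicit Arguments.
Unset Strict Implicit.
Unset Printing Implicit Defensive.

(** Let t be the integer part of (k - 1) / 2, let G be a candidate with n vertices,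
    and let C be a longest cycle of G, of length c < k. Write h for the integer part
    of c / 2, so that h <= t. The edges inside C and those that meet the outside of C
    are counted separately.

    Outside C, everything rests on [bridge_weight]: a component of G - C with
    d >= 2 vertices meets at most (h - 1/2) d edges. A component with one vertex
    meets at most h edges, since no two neighbours of an outside vertex are
    consecutive on C. So at most h (n - c) edges meet the outside, and at most
    (h - 1/2) (n - c) unless some outside vertex v has exactly h neighbours on C.

    If h < t or there is no such v, the loss of at least half an edge for each of the
    n - c outside vertices is so large, because n >= k^2 / 2, that C might even span a
    complete graph ([longest_cycle_bound]).

    Otherwise h = t, and the set A of neighbours of v on C has t elements, almost
    alternating on C. The remaining vertices B of C span no edge if c = 2 t and at
    most one if c = 2 t + 1 ([darts_off_alternating]), by the usual exchange on a
    longest cycle. There is no K_(r-1) in A, because v would extend it to K_r. So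
    Turán's theorem bounds the edges inside A by those of T(t, r - 2). An edge xy in B
    is compensated: a pair in A x B is missing, or x and y extend every clique of A,
    and then A has no K_(r-2) and fewer edges ([turan_lt]). Adding up gives
    e(T(t, r - 2)) + t (n - t), the number of edges of G_2 ([alternating_bound]).

    The bound for a component D is proved by induction, contracting edges of D. The
    argument only uses that D is joined to C in a 2-connected way and that a path
    through D between two vertices of C has fewer inner vertices than each arc of C
    between these vertices has edges (the record [bridge]). Take a longest such path
    and let p be its number of inner vertices. Contracting an edge xy of it inside D
    keeps D a bridge: if {x, y} cut off a part of D from C, the path could be
    lengthened by a detour through that part ([ear_contractible]). The contraction
    loses one edge more than x and y have common neighbours. If this is at most h - 1
    for some xy, induct. Otherwise every xy has many common neighbours. Those in D are
    on the path, again for want of a detour, so at least h + 1 - p are on C. But the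
    ends of the path have at most h + 1 - p neighbours on C, because neighbours of
    different ends are more than p apart ([ear_ends_bound]). This forces D to be a
    clique of p vertices, each with h + 1 - p neighbours on C ([dense_weight]), and
    the bound is a direct count.

    Conversely, G_2 is a candidate: a clique uses at most one vertex of each part, and
    at most half of the vertices of a cycle are in the independent part. *)

(** * Counting adjacent pairs *)

Lemma sum_setU (T : finType) (A B : {set T}) (F : T -> nat) :
  [disjoint A & B] ->
  \sum_(u in A :|: B) F u = \sum_(u in A) F u + \sum_(u in B) F u.
Proof. by move=> dAB; rewrite -bigU //; apply: eq_bigl => u; rewrite !inE. Qed.

Section Darts.
Variable T : finType.
Implicit Types (e : rel T) (A B S Q : {set T}).

(** Ordered pairs rather than edges: sums over A and B split without case
    distinctions, and darts e A A is twice the number of edges inside A. *)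
Definition darts e A B : nat := \sum_(u in A) \sum_(v in B) (e u v : nat).

Definition nbrs e S u : {set T} := [set v in S | e u v].

Definition clique e Q := {in Q &, forall u v, u != v -> e u v}.

Lemma in_nbrs e S u v : (v \in nbrs e S u) = (v \in S) && e u v.
Proof. by rewrite inE. Qed.

Lemma card_nbrs e S u : #|nbrs e S u| = \sum_(v in S) (e u v : nat).
Proof.
rewrite /nbrs -sum1_card big_mkcond [RHS]big_mkcond /=.
by apply: eq_bigr => v _; rewrite inE; case: (v \in S) => //=; case: (e u v).
Qed.

Lemma dartsE e A B : darts e A B = \sum_(u in A) #|nbrs e B u|.
Proof. by apply: eq_bigr => u _; rewrite card_nbrs. Qed.

Lemma darts_sym e A B : symmetric e -> darts e A B = darts e B A.
Proof.
move=> sym; rewrite /darts exchange_big /=.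
by apply: eq_bigr => u _; apply: eq_bigr => v _; rewrite sym.
Qed.

Lemma dartsUl e A A' B :
  [disjoint A & A'] -> darts e (A :|: A') B = darts e A B + darts e A' B.
Proof. by move=> dA; rewrite /darts sum_setU. Qed.

Lemma dartsUr e A B B' :
  [disjoint B & B'] -> darts e A (B :|: B') = darts e A B + darts e A B'.
Proof.
by move=> dB; rewrite /darts -big_split; apply: eq_bigr => u _; rewrite sum_setU.
Qed.

Lemma darts_le e A B : darts e A B <= #|A| * #|B|.
Proof.
rewrite dartsE -sum_nat_const; apply: leq_sum => u _.
by apply: subset_leq_card; apply/subsetP=> v; rewrite inE => /andP[].
Qed.

Lemma darts_missing e A B u v :
  u \in A -> v \in B -> ~~ e u v -> darts e A B < #|A| * #|B|.
Proof.
move=> uA vB nuv; rewrite dartsE -sum_nat_const (bigD1 u) //= [ltnRHS](bigD1 u) //=.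
rewrite -addSn; apply: leq_add.
  apply: proper_card; apply/properP; split.
    by apply/subsetP=> w; rewrite inE => /andP[].
  by exists v => //; rewrite inE vB.
apply: leq_sum => w _.
by apply: subset_leq_card; apply/subsetP=> z; rewrite inE => /andP[].
Qed.

Lemma darts_eq0 e A B :
  {in A & B, forall u v, ~~ e u v} -> darts e A B = 0.
Proof.
move=> h; rewrite /darts big1 // => u uA; rewrite big1 // => v vB.
by rewrite (negbTE (h _ _ uA vB)).
Qed.

Lemma eq_darts e e' A B :
  {in A & B, forall u v, e u v = e' u v} -> darts e A B = darts e' A B.
Proof. by move=> h; apply: eq_bigr => u uA; apply: eq_bigr => v vB; rewrite h. Qed.

Lemma darts1l e B x : darts e [set x] B = \sum_(v in B) (e x v : nat).
Proof. by rewrite /darts big_set1. Qed.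

Lemma darts_setU1 e A x : symmetric e -> irreflexive e -> x \notin A ->
  darts e (x |: A) (x |: A) = darts e A A + 2 * \sum_(v in A) (e x v : nat).
Proof.
move=> sym irr xA.
have d : [disjoint [set x] & A] by rewrite disjoints1.
rewrite dartsUl // !dartsUr // (darts_sym A [set x] sym) !darts1l.
by rewrite big_set1 irr /=; lia.
Qed.

Lemma darts_setD1 e A x : symmetric e -> irreflexive e -> x \in A ->
  darts e A A = darts e (A :\ x) (A :\ x) + 2 * #|nbrs e A x|.
Proof.
move=> sym irr xA; rewrite -{1 2}(setD1K xA) darts_setU1 ?setD11 //.
by rewrite card_nbrs [in RHS](big_setD1 x) //= irr.
Qed.

Lemma darts_irr_le e A : irreflexive e -> darts e A A <= #|A| * #|A|.-1.
Proof.
move=> irr; rewrite dartsE -sum_nat_const; apply: leq_sum => u uA.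
rewrite -(@ltn_predK 0 #|A|) ?(cardsD1 u A) ?uA //=; apply: subset_leq_card.
apply/subsetP=> v; rewrite !inE => /andP[-> uv]; rewrite andbT.
by apply: contraTneq uv => ->; rewrite irr.
Qed.

End Darts.

(** Every unordered edge is the image of exactly two ordered pairs. *)
Lemma num_edges_darts (G : sgraph) :
  2 * num_edges G = darts (@adj G) setT setT.
Proof.
pose E := [set p : G * G | adj p.1 p.2].
have -> : darts (@adj G) setT setT = #|E|.
  rewrite -sum1_card /darts pair_big /= [RHS]big_mkcond /= big_mkcond /=.
  by apply: eq_bigr => -[u v] _; rewrite !inE /=; case: (adj u v).
rewrite /num_edges /edge_set -[RHS]sum1_card.
rewrite (@partition_big_imset _ _ _ _ _ (fun p : G * G => [set p.1; p.2])) /=.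
have -> : [set [set p.1; p.2] | p : G * G & adj p.1 p.2] = [set [set p.1; p.2] | p in E].
  by apply/setP=> S; apply/imsetP/imsetP=> -[p]; rewrite ?inE => hp ->;
     exists p; rewrite ?inE.
rewrite mulnC -sum_nat_const; apply: eq_bigr => S /imsetP[[a b]].
rewrite inE /= => ab ->.
have nab : a != b by apply: contraTneq ab => ->; rewrite adj_irrefl.
rewrite sum1dep_card -(_ : #|[set (a, b); (b, a)]| = 2); last first.
  by rewrite cards2 xpair_eqE (negbTE nab).
apply: eq_card => -[u v]; rewrite !inE /= !xpair_eqE.
apply/orP/andP.
  case=> /andP[/eqP-> /eqP->]; first by rewrite eqxx.
  by rewrite adj_sym setUC eqxx.
case=> uv /eqP/setP h.
have := h u; have := h v; have := h a; have := h b.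
have nuv : u != v by apply: contraTneq uv => ->; rewrite adj_irrefl.
rewrite !inE !eqxx /= orbT.
case: (altP (u =P a)) => [-> | nua].
  move=> hb _ _ _; left; move: hb; rewrite [b == a]eq_sym (negbTE nab) /= eq_sym.
  by move=> ->.
move=> _ _ _ /esym/eqP ub; right; rewrite ub.
have := h a; rewrite !inE eqxx /= eq_sym (negbTE nua) /= => /eqP ->.
by rewrite !eqxx.
Qed.

(** * Turán's theorem *)

(** Number of edges of T(m, s), counted vertex by vertex: the residue class of i
    mod s contains i %/ s of the vertices below i. *)
Definition turan_number m s := \sum_(0 <= i < m) (i - i %/ s).

Lemma count_congruent m s : 0 < s ->
  \sum_(0 <= j < m) (j %% s == m %% s : nat) = m %/ s.
Proof.
move=> s0; rewrite divn_count_dvd big_add1 /= big_nat_rev /= add0n.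
apply: eq_big_nat => j /andP[_ jm].
rewrite (_ : m = (m - j.+1) + j.+1) ?[in RHS](_ : _) //; last lia.
rewrite {1}(_ : m - j.+1 + j.+1 - j.+1 = m - j.+1); last lia.
rewrite -{1}[m - j.+1]addn0 eqn_modDl mod0n.
by rewrite [0 == _]eq_sym.
Qed.

Lemma turan_darts m s : 0 < s ->
  darts (@turan_adj m s) setT setT = 2 * turan_number m s.
Proof.
move=> s0.
have -> : darts (@turan_adj m s) setT setT =
   \sum_(0 <= i < m) \sum_(0 <= j < m) (i %% s != j %% s : nat).
  rewrite big_mkord /darts; apply: eq_big => [u|u _]; first by rewrite inE.
  by rewrite big_mkord; apply: eq_bigl => v; rewrite inE.
rewrite /turan_number; elim: m => [|m IH]; first by rewrite !big_geq.
rewrite !big_nat_recr //= eqxx /= addn0.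
under eq_bigr do rewrite big_nat_recr //=.
rewrite big_split /= IH.
have h : \sum_(0 <= j < m) (j %% s != m %% s : nat) = m - m %/ s.
  rewrite -(count_congruent m s0) -[X in X - _](_ : \sum_(0 <= j < m) 1 = _); last first.
    by rewrite sum_nat_const_nat; lia.
  rewrite -sumnB; last by move=> j _; case: (_ == _).
  by apply: eq_bigr => j _; case: (_ == _).
rewrite h (eq_bigr _ (fun j _ => congr1 (fun b => nat_of_bool (~~ b)) (eq_sym _ _))) h; lia.
Qed.

Section Turan.
Variable T : finType.
Implicit Types (e : rel T) (A Q : {set T}).

Lemma clique_setU1 e Q x : symmetric e -> clique e Q ->
  {in Q, forall u, e x u} -> clique e (x |: Q).
Proof.
move=> sym cQ xQ u v; rewrite !inE.
case/predU1P=> [->|uQ] /predU1P[->|vQ]; rewrite ?eqxx //.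
- by move=> _; apply: xQ.
- by move=> _; rewrite sym; apply: xQ.
- exact: cQ.
Qed.

Lemma subset_of_size A m : m <= #|A| -> exists2 Q : {set T}, Q \subset A & #|Q| = m.
Proof.
elim: m => [|m IH] h; first by exists set0; rewrite ?sub0set ?cards0.
have [Q sQ cQ] := IH (ltnW h).
have /properP[_ [x xA xQ]] : Q \proper A by rewrite properEcard sQ cQ.
exists (x |: Q); last by rewrite cardsU1 xQ cQ.
by rewrite subUset sub1set xA.
Qed.

(** If every vertex misses fewer than |A| / s vertices of A (itself included), then
    s vertices together miss fewer than |A|, so a clique of at most s vertices can
    always be enlarged. *)
Lemma greedy_clique e A s : symmetric e -> irreflexive e -> 0 < #|A| ->
  {in A, forall u, #|[set v in A | ~~ e u v]| * s < #|A|} ->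
  exists Q, [/\ Q \subset A, clique e Q & #|Q| = s.+1].
Proof.
move=> sym irr A0 few.
suff H j : j <= s -> exists Q, [/\ Q \subset A, clique e Q & #|Q| = j.+1] by exact: H.
elim: j => [_|j IH js].
  have [x xA] := card_gt0P A0.
  exists [set x]; rewrite sub1set xA cards1; split=> // u v.
  by rewrite !inE => /eqP-> /eqP->; rewrite eqxx.
have [Q [sQ cQ szQ]] := IH (ltnW js).
pose N := \bigcup_(u in Q) [set v in A | ~~ e u v].
have ltN : #|N| < #|A|.
  have le1 : #|N| <= \sum_(u in Q) #|[set v in A | ~~ e u v]|.
    rewrite /N; elim/big_ind2: _ => [|m1 n1 m2 n2 h1 h2|//]; first by rewrite cards0.
    by rewrite (leq_trans (leq_card_setU _ _)) // leq_add.
  have le2 : (\sum_(u in Q) #|[set v in A | ~~ e u v]|) * s <= #|Q| * #|A|.-1.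
    rewrite big_distrl -sum_nat_const; apply: leq_sum => u uQ.
    by have := few u (subsetP sQ u uQ); case: #|A|.
  have : #|N| * s <= s * #|A|.-1.
    by apply: leq_trans (leq_mul le1 (leqnn s)) (leq_trans le2 _); rewrite leq_mul2r szQ js orbT.
  by rewrite mulnC leq_pmul2l; [case: #|A| A0 | exact: leq_trans js].
have /subsetPn[x xA xN] : ~~ (A \subset N).
  by apply: contraL ltN => /subset_leq_card; rewrite -leqNgt.
have xQ : {in Q, forall u, e x u}.
  move=> u uQ; apply: contraNT xN => nux; apply/bigcupP; exists u => //.
  by rewrite inE xA sym.
have nxQ : x \notin Q by apply/negP=> /xQ; rewrite irr.
exists (x |: Q); split; last by rewrite cardsU1 nxQ szQ.
- by rewrite subUset sub1set xA.
- exact: clique_setU1.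
Qed.

(** Induction on |A|: by [greedy_clique] some vertex misses at least |A| / s
    vertices, so its degree is at most the last summand of the Turán number.
    Deleting it lowers the bound by that summand. *)
Theorem turan e A s : symmetric e -> irreflexive e -> 0 < s ->
  (forall Q, Q \subset A -> clique e Q -> #|Q| != s.+1) ->
  darts e A A <= 2 * turan_number #|A| s.
Proof.
move=> sym irr s0; move cA: #|A| => m.
elim: m A cA => [|m IH] A cA free.
  by move/eqP: cA; rewrite cards_eq0 => /eqP->; rewrite /darts big_set0.
have [/forallP few|] := boolP [forall u in A, #|[set v in A | ~~ e u v]| * s < #|A|].
  have A0 : 0 < #|A| by rewrite cA.
  have few' : {in A, forall u, #|[set v in A | ~~ e u v]| * s < #|A|}.
    by move=> u uA; have := few u; rewrite uA.
  have [Q [sQ cQ szQ]] := greedy_clique sym irr A0 few'.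
  by have := free Q sQ cQ; rewrite szQ eqxx.
rewrite negb_forall => /existsP[x]; rewrite negb_imply -leqNgt => /andP[xA many].
have cA' : #|A :\ x| = m by have := cardsD1 x A; rewrite xA cA; lia.
have free' Q : Q \subset A :\ x -> clique e Q -> #|Q| != s.+1.
  by move=> sQ; apply: free; apply: subset_trans sQ (subsetDl _ _).
rewrite (darts_setD1 sym irr xA) /turan_number big_nat_recr //= -/(turan_number m s) mulnDr.
apply: leq_add; first exact: IH.
rewrite leq_mul2l /=.
have split : #|nbrs e A x| + #|[set v in A | ~~ e x v]| = m.+1.
  rewrite -cA -(cardsID [set v | e x v] A); congr (_ + _).
    by apply: eq_card => v; rewrite !inE.
  by apply: eq_card => v; rewrite !inE andbC.
have : m %/ s < #|[set v in A | ~~ e x v]| by rewrite ltn_divLR // -cA.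
lia.
Qed.

(** A set without K_s, of size at least s, has a missing edge, and adding it
    cannot create K_(s+1). Turán's theorem for the enlarged graph is what pays, in
    the extremal argument, for one surplus edge on the cycle. *)
Corollary turan_lt e A s : symmetric e -> irreflexive e -> 0 < s <= #|A| ->
  (forall Q, Q \subset A -> clique e Q -> #|Q| != s) ->
  darts e A A + 2 <= 2 * turan_number #|A| s.
Proof.
move=> sym irr /andP[s0 sA] free.
have [u [w [uA wA uw nuw]]] : exists u w, [/\ u \in A, w \in A, u != w & ~~ e u w].
  have [Q sQ cQ] := subset_of_size sA.
  have [/existsP[u /existsP[w /and4P[]]]|] :=
    boolP [exists u, exists w, [&& u \in A, w \in A, u != w & ~~ e u w]].
    by exists u, w.
  rewrite negb_exists => /forallP noex; exfalso.
  suff /(free Q sQ) : clique e Q by rewrite cQ eqxx.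
  move=> u v uQ vQ uv; have := noex u; rewrite negb_exists => /forallP/(_ v).
  by rewrite !(subsetP sQ) //= uv /= negbK.
pose e' : rel T := fun a b => [|| e a b, (a == u) && (b == w) | (a == w) && (b == u)].
have sym' : symmetric e'.
  move=> a b; rewrite /e' sym; congr (_ || _); rewrite orbC.
  by congr (_ || _); rewrite andbC.
have irr' : irreflexive e'.
  move=> a; rewrite /e' irr /=; apply/negbTE; rewrite negb_or andbC.
  by apply/andP; split; apply: contraNN uw => /andP[/eqP<- /eqP<-].
have -> : darts e A A + 2 = darts e' A A.
  rewrite (darts_setD1 sym irr wA) (darts_setD1 sym' irr' wA).
  have -> : darts e (A :\ w) (A :\ w) = darts e' (A :\ w) (A :\ w).
    apply: eq_darts => a b; rewrite !inE /e' => /andP[/negbTE-> _] /andP[/negbTE-> _].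
    by rewrite andbF orbF.
  have -> : nbrs e' A w = u |: nbrs e A w.
    apply/setP=> v; rewrite !inE /e' eqxx [w == u]eq_sym (negbTE uw) /=.
    by case: eqP => [->|_]; rewrite ?uA ?orbT ?orbF.
  by rewrite cardsU1 inE uA sym (negbTE nuw) /=; lia.
apply: turan => // Q sQ cQ; apply/eqP=> szQ.
have [x xQ wx] : exists2 x, x \in Q & w \in Q -> x = w.
  have [wQ|wQ] := boolP (w \in Q); first by exists w.
  have /card_gt0P[x xQ] : 0 < #|Q| by rewrite szQ.
  by exists x.
have sQx : Q :\ x \subset A by apply: subset_trans (subsetDl _ _) sQ.
have wQx : w \notin Q :\ x.
  by rewrite !inE negb_and negbK; case wQ: (w \in Q); rewrite ?orbT //= (wx wQ) eqxx.
have cQx : clique e (Q :\ x).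
  move=> a b aQ bQ ab; have := cQ a b; rewrite /e'.
  have -> : (a == w) = false by apply: contraNF wQx => /eqP<-.
  have -> : (b == w) = false by apply: contraNF wQx => /eqP<-.
  rewrite andbF !orbF; apply=> //.
    by move: aQ; rewrite inE => /andP[].
  by move: bQ; rewrite inE => /andP[].
by have := free _ sQx cQx; have := cardsD1 x Q; rewrite xQ szQ add1n => -[<-]; rewrite eqxx.
Qed.

End Turan.

(** * Gaps between marked positions on a cycle *)

(** U and W are unrolled to all natural numbers, with period m, so that both arcs
    between two positions are intervals. Marked positions are at distance at least
    2, and at distance more than p if one lies in U and the other in W. An arc from
    U to W contains a gap from one set to the other, and so does the arc back: each of
    these two gaps contributes p.-1 additional positions in [marked_cycle]. *)
Section Gaps.
Variables (m p : nat) (U W : pred nat).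
Notation X := (fun n => U n || W n).
Hypothesis p_gt0 : 0 < p.
Hypothesis spread : forall i j, i < j < i + m -> j < 2 * m -> X i -> X j -> 2 <= j - i.
Hypothesis mixed : forall i j, i < j < i + m -> j < 2 * m ->
  (U i && W j) || (W i && U j) -> p < j - i.

Lemma marked_interval i j : i <= j < i + m -> j < 2 * m -> X i -> X j ->
  2 * \sum_(i <= n < j) (X n : nat) <= j - i.
Proof.
have [d] := ubnP (j - i); elim: d i j => // d IH i j; rewrite ltnS => dij ij jm Xi Xj.
have [->|lt_ij] := eqVneq i j; first by rewrite big_geq.
have {}lt_ij : i < j by lia.
(* Split at an intermediate mark, if there is one. *)
have [/hasP[x]|/hasPn none] := boolP (has X (index_iota i.+1 j)).
  rewrite mem_index_iota => xij Xx.
  rewrite (@big_cat_nat _ _ _ x) /=; try lia.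
  have := IH i x; have := IH x j; lia.
rewrite big_ltn // big_nat_cond big1 => [|n /andP[nij _]].
  by have := spread (i := i) (j := j); rewrite Xi Xj; lia.
by have := none n; rewrite mem_index_iota => /(_ nij); case: (X n).
Qed.

Lemma mixed_interval i j : i < j < i + m -> j < 2 * m ->
  (U i && W j) || (W i && U j) ->
  2 * \sum_(i <= n < j) (X n : nat) + p.-1 <= j - i.
Proof.
have [d] := ubnP (j - i); elim: d i j => // d IH i j; rewrite ltnS => dij ij jm UW.
have [/hasP[x]|/hasPn none] := boolP (has X (index_iota i.+1 j)); last first.
  rewrite big_ltn; last by case/andP: ij.
  have -> : \sum_(i.+1 <= n < j) (X n : nat) = 0 :> nat.
    rewrite big_nat_cond big1 // => n /andP[nij _].
    by have := none n; rewrite mem_index_iota => /(_ nij); case: (X n).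
  have := mixed ij jm UW; have : (X i : nat) <= 1 by case: (X i).
  by move: (X i : nat) p_gt0; clear; lia.
  rewrite mem_index_iota => xij Xx.
  have [Xi Xj] : X i /\ X j by move: UW => /orP[] /andP[-> ->]; rewrite ?orbT.
  rewrite (@big_cat_nat _ _ _ x) /=; try lia.
  have pix := @marked_interval i x; have pxj := @marked_interval x j.
  have [mx|mx] : (U i && W x) || (W i && U x) \/ (U x && W j) || (W x && U j).
    apply/orP; move: UW Xx; case: (U i); case: (W i); case: (U j); case: (W j);
    by case: (U x); case: (W x).
  - have := IH i x; lia.
  - have := IH x j; lia.
Qed.

Hypothesis period : forall n, U (m + n) = U n /\ W (m + n) = W n.

Lemma marked_cycle i j : i < m -> j < m -> i != j -> U i -> W j ->
  2 * \sum_(0 <= n < m) (X n : nat) + 2 * p.-1 <= m.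
Proof.
have around i' : i' < m ->
    \sum_(i' <= n < i' + m) (X n : nat) = \sum_(0 <= n < m) (X n : nat).
  move=> im; rewrite (@big_cat_nat _ _ _ m) /=; try lia.
  rewrite [RHS](@big_cat_nat _ _ _ i') /=; try lia.
  rewrite addnC; congr (_ + _).
  rewrite -{1}[m]add0n big_addn (_ : i' + m - m = i'); last by lia.
  by apply: eq_bigr => n _; rewrite addnC !(proj1 (period n)) !(proj2 (period n)).
have main a b : a < b -> b < m -> (U a && W b) || (W a && U b) ->
    2 * \sum_(0 <= n < m) (X n : nat) + 2 * p.-1 <= m.
  move=> ab bm UW; rewrite -(around a); last by lia.
  rewrite (@big_cat_nat _ _ _ b) /=; try lia.
  have := @mixed_interval a b; have := @mixed_interval b (a + m).
  rewrite [a + m]addnC !(proj1 (period a)) !(proj2 (period a)); lia.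
move=> im jm ij Ui Wj; have [lt|lt] : i < j \/ j < i by lia.
  by apply: (main i j); rewrite // Ui Wj.
by apply: (main j i); rewrite // Ui Wj orbT.
Qed.

End Gaps.

(** * Walks inside a set *)

Section Inside.
Variable T : finType.
Implicit Types (e : rel T) (A B D : {set T}) (s q : seq T).

Definition inside e A : rel T := fun u v => [&& u \in A, v \in A & e u v].

Lemma inside_sym e A : symmetric e -> connect_sym (inside e A).
Proof. by move=> sym; apply: sym_connect_sym => u v; rewrite /inside andbCA sym. Qed.

(** Walks are mapped step by step; a step may collapse or be stretched. *)
Lemma connect_hom (S : finType) (r : rel T) (r' : rel S) (f : T -> S) u v :
  (forall a b, r a b -> connect r' (f a) (f b)) ->
  connect r u v -> connect r' (f u) (f v).
Proof.
move=> h /connectP[q]; elim: q u => [|w q IH] u /=; first by move=> _ ->.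
by case/andP=> /h uw /IH /[apply]; apply: connect_trans.
Qed.

Lemma inside_mono e A B u v : A \subset B ->
  connect (inside e A) u v -> connect (inside e B) u v.
Proof.
move=> /subsetP sAB; apply: (@connect_hom T _ _ id) => a b /and3P[aA bA ab].
by apply: connect1; rewrite /inside !sAB.
Qed.

Lemma inside_mem e A u v : connect (inside e A) u v -> u \in A -> v \in A.
Proof.
case/connectP=> q; elim: q u => [|w q IH] u /=; first by move=> _ ->.
by case/andP=> /and3P[_ wA _] /IH /[apply] h _; apply: h.
Qed.

Lemma path_inside e A u q : u \in A -> {subset q <= A} -> path e u q ->
  path (inside e A) u q.
Proof.
elim: q u => //= w q IH u uA sA /andP[uw pq].
have wA : w \in A by apply: sA; rewrite mem_head.
rewrite /inside uA wA uw /=; apply: IH => // x xq.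
by apply: sA; rewrite inE xq orbT.
Qed.

Lemma connect_path e A u q : u \in A -> {subset q <= A} -> path e u q ->
  connect (inside e A) u (last u q).
Proof. by move=> uA sA pq; apply/connectP; exists q; rewrite ?path_inside. Qed.

Lemma connect_path_mem e A u q w : {subset u :: q <= A} -> path e u q ->
  w \in u :: q -> connect (inside e A) u w.
Proof.
move=> sA pq wq; case/splitPl: wq sA pq => q1 q2 <- sA.
rewrite cat_path => /andP[pq1 _]; apply: connect_path pq1.
  by apply: sA; rewrite mem_head.
by move=> x xq; apply: sA; rewrite inE mem_cat xq orbT.
Qed.

Lemma inside_path e A u v : connect (inside e A) u v -> u \in A ->
  exists q, [/\ path e u q, uniq (u :: q), last u q = v & {subset u :: q <= A}].
Proof.
case/connectP=> q0 /shortenP[q pq uq _] -> uA; exists q; split=> //.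
  by apply: sub_path pq => a b /and3P[].
move: pq; elim: q u uA {q0 uq} => [|w q IH] u uA /=.
  by move=> _ x; rewrite inE => /eqP->.
case/andP=> /and3P[_ wA _] /(IH _ wA) sA x.
by rewrite inE => /predU1P[->|/sA].
Qed.

(** The first visit to B, if the walk reaches B at all. *)
Lemma avoid_or_hit e A B u v : connect (inside e A) u v -> u \notin B ->
  connect (inside e (A :\: B)) u v \/
  exists w b, [/\ connect (inside e (A :\: B)) u w, b \in A :&: B & e w b].
Proof.
case/connectP=> q; elim: q u => [|w q IH] u /=.
  by move=> _ -> _; left; apply: connect0.
case/andP=> /and3P[uA wA uw] pq ev uB.
have [wB|wB] := boolP (w \in B).
  by right; exists u, w; rewrite connect0 inE wA.
have uw' : connect (inside e (A :\: B)) u w.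
  by apply: connect1; rewrite /inside !inE uA wA uB wB.
have [h|[x [b [h1 h2 h3]]]] := IH w pq ev wB; [left|right].
  exact: connect_trans h.
by exists x, b; split=> //; apply: connect_trans h1.
Qed.

Lemma connect_within e A D u v : {in D, forall x y, inside e A x y -> y \in D} ->
  u \in D -> connect (inside e A) u v -> connect (inside e (A :&: D)) u v.
Proof.
move=> cD uD /connectP[q]; elim: q u uD => [|w q IH] u uD /=.
  by move=> _ ->; apply: connect0.
case/andP=> uw pq ev; have wD := cD u uD w uw; case/and3P: uw => uA wA uw.
apply: connect_trans (IH w wD pq ev); apply: connect1.
by rewrite /inside !inE uA wA uD wD.
Qed.

Lemma path_rev e a b s : symmetric e ->
  path e a (rcons s b) = path e b (rcons (rev s) a).
Proof.
move=> sym; rewrite -{2}(last_rcons a s b) -rev_cons -(belast_rcons a s b) rev_path.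
by apply: eq_path => u v; rewrite sym.
Qed.

Lemma clique_path e s u q : {in s &, forall x y, x != y -> e x y} ->
  uniq (u :: q) -> {subset u :: q <= s} -> path e u q.
Proof.
move=> cl; elim: q u => //= w q IH u /andP[uwq uq] sub.
rewrite IH ?andbT //.
  apply: cl; rewrite ?sub ?inE ?eqxx ?orbT //.
  by apply: contraNneq uwq => ->; rewrite mem_head.
by move=> x xq; apply: sub; rewrite inE xq orbT.
Qed.

End Inside.

(** * Bridges of a cycle *)

Section Bridge.
Variables (T : finType) (C : {set T}) (pos : T -> nat) (c : nat).
Hypothesis pos_inj : {in C &, injective pos}.
Hypothesis pos_lt : {in C, forall a, pos a < c}.
Implicit Types (e : rel T) (D : {set T}) (s q : seq T).

(** For positions i and j on a cycle of length c: both arcs from i to j have more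
    than l edges. The sum of the two truncated differences is the distance between
    i and j as numbers. *)
Definition far l i j :=
  (l < (i - j) + (j - i)) && (l + ((i - j) + (j - i)) < c).

(** The properties of a component D of G - C, for a longest cycle C of a
    2-connected graph G, that survive the contraction of edges inside D.
    [bridge_avoid] is 2-connectivity: no vertex of D separates a part of D from C.
    [bridge_far] is all that is kept of the maximality of C: a path through D
    cannot be longer than the arcs of C that it could replace. The positions [pos]
    of the vertices of C are the only trace of the cycle itself. *)
Record bridge e D : Prop := Bridge {
  bridge_sym : symmetric e;
  bridge_irr : irreflexive e;
  bridge_disj : [disjoint D & C];
  bridge_conn : {in D &, forall u v, connect (inside e D) u v};
  bridge_avoid : {in D &, forall w z, z != w -> exists v b,
    [/\ connect (inside e (D :\ w)) z v, b \in C & e v b]};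
  bridge_two : exists u v a b,
    [/\ u \in D, v \in D, a \in C /\ b \in C, a != b & e u a && e v b];
  bridge_far : forall a b s, a \in C -> b \in C -> a != b -> uniq s ->
    {subset s <= D} -> path e a (rcons s b) -> far (size s) (pos a) (pos b) }.

(** Twice the number of edges with one end in D and the other in D or C. *)
Definition weight e D := darts e D D + 2 * darts e D C.

(** The sequence s lists the inner vertices of a path through D between two
    distinct vertices of C. *)
Definition ear e D s :=
  [&& uniq s, all (mem D) s &
   [exists a in C, exists b in C, (a != b) && path e a (rcons s b)]].

Lemma earP e D s : reflect
  [/\ uniq s, {subset s <= D} & exists a b,
     [/\ a \in C, b \in C, a != b & path e a (rcons s b)]] (ear e D s).
Proof.
apply: (iffP and3P) => -[us sD].
  case/exists_inP=> a aC /exists_inP[b bC /andP[ab p]]; split=> //.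
    by move=> x xs; apply: (allP sD).
  by exists a, b.
case=> a [b [aC bC ab p]]; split=> //; first by apply/allP.
by apply/exists_inP; exists a => //; apply/exists_inP; exists b => //; rewrite ab.
Qed.

Lemma modn_window n : n < 2 * c -> n %% c = if n < c then n else n - c.
Proof.
move=> n2; case: ltnP => nc; first by rewrite modn_small.
by rewrite -{1}(subnK nc) modnDr modn_small //; lia.
Qed.

Lemma far_unroll l i j : i < j < i + c -> j < 2 * c ->
  (i %% c != j %% c -> far l (i %% c) (j %% c)) -> l < j - i.
Proof.
move=> ij jc; rewrite !modn_window /far; try lia.
case: (ltnP i c) => ic; case: (ltnP j c) => jc' h.
- have /h : i != j by lia.
  lia.
- have /h : i != j - c by lia.
  lia.
- lia.
- have /h : i - c != j - c by lia.
  lia.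
Qed.

(** Positions are distinct, so the marks count the vertices that they come from. *)
Lemma card_marks (P : pred T) : #|[set a in C | P a]| <=
  \sum_(0 <= n < c) ([exists a in C, (pos a == n %% c) && P a] : nat).
Proof.
set S := [set a in C | P a].
have -> : #|S| = size (map pos (enum S)) by rewrite size_map cardE.
pose Q n := [exists a in C, (pos a == n %% c) && P a].
have -> : \sum_(0 <= n < c) (Q n : nat) = size (filter Q (index_iota 0 c)).
  by rewrite size_filter -sum1_count [RHS]big_mkcond; apply: eq_bigr => n _; case: (Q n).
apply: uniq_leq_size.
  rewrite map_inj_in_uniq ?enum_uniq // => a b.
  by rewrite !mem_enum !inE => /andP[aC _] /andP[bC _]; apply: pos_inj.
move=> n /mapP[a]; rewrite mem_enum inE => /andP[aC Pa] ->.
rewrite mem_filter mem_index_iota pos_lt //= /Q andbT.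
apply/exists_inP; exists a => //; rewrite Pa modn_small ?eqxx ?pos_lt //.
Qed.

(** The attachments of the two ends of a path through D are marks on the cycle:
    two attachments of the same vertex are at distance at least 2, and attachments
    of different ends at distance more than the number of vertices of the path.
    Hence [marked_cycle] applies. *)
Lemma ear_ends_bound e D z s a b : bridge e D -> uniq (z :: s) -> {subset z :: s <= D} ->
  path e z s -> a \in C -> b \in C -> a != b -> e z a -> e (last z s) b ->
  2 * #|nbrs e C z :|: nbrs e C (last z s)| + 2 * size s <= c.
Proof.
move=> brD us sD ps aC bC ab za zb.
have farzz x y : x \in C -> y \in C -> x != y -> e z x -> e z y -> far 1 (pos x) (pos y).
  move=> xC yC xy zx zy; apply: (bridge_far brD (s := [:: z])) => //=.
    by move=> w; rewrite inE => /eqP->; apply: sD; rewrite mem_head.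
  by rewrite (bridge_sym brD) zx zy.
have farll x y : x \in C -> y \in C -> x != y -> e (last z s) x -> e (last z s) y ->
    far 1 (pos x) (pos y).
  move=> xC yC xy zx zy; apply: (bridge_far brD (s := [:: last z s])) => //=.
    by move=> w; rewrite inE => /eqP->; apply: sD; rewrite mem_last.
  by rewrite (bridge_sym brD) zx zy.
have farzl x y : x \in C -> y \in C -> x != y -> e z x -> e (last z s) y ->
    far (size s).+1 (pos x) (pos y).
  move=> xC yC xy zx zy; apply: (bridge_far brD (s := z :: s)) => //=.
  by rewrite (bridge_sym brD) zx rcons_path ps.
have farlz x y : x \in C -> y \in C -> x != y -> e (last z s) x -> e z y ->
    far (size s).+1 (pos x) (pos y).
  move=> xC yC xy zx zy; have := farzl y x yC xC; rewrite eq_sym => /(_ xy zy zx).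
  by rewrite /far; clear; lia.
pose U n := [exists a in C, (pos a == n %% c) && e z a].
pose W n := [exists a in C, (pos a == n %% c) && e (last z s) a].
have markU n : U n -> exists x, [/\ x \in C, pos x = n %% c & e z x].
  by case/exists_inP=> x xC /andP[/eqP px zx]; exists x.
have markW n : W n -> exists x, [/\ x \in C, pos x = n %% c & e (last z s) x].
  by case/exists_inP=> x xC /andP[/eqP px zx]; exists x.
have unroll l i j x y : i < j < i + c -> j < 2 * c -> pos x = i %% c -> pos y = j %% c ->
    (x != y -> far l (pos x) (pos y)) -> l < j - i.
  move=> ij jc px py h; apply: (far_unroll ij jc); rewrite -px -py => ne; apply: h.
  by apply: contraNneq ne => ->.
have gapl : 2 * \sum_(0 <= n < c) (U n || W n : nat) + 2 * (size s).+1.-1 <= c.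
  apply: (@marked_cycle c (size s).+1 U W _ _ _ _ (pos a) (pos b)) => //.
  - move=> i j ij jc /orP[/markU|/markW] [x [xC px ex]] /orP[/markU|/markW] [y [yC py ey]];
      apply: (unroll 1 i j x y) => // xy.
    + exact: farzz.
    + by have := farzl x y xC yC xy ex ey; rewrite /far; clear; lia.
    + by have := farlz x y xC yC xy ex ey; rewrite /far; clear; lia.
    + exact: farll.
  - move=> i j ij jc /orP[] /andP[].
      by move=> /markU[x [xC px ex]] /markW[y [yC py ey]];
         apply: (unroll _ i j x y) => // xy; apply: farzl.
    by move=> /markW[x [xC px ex]] /markU[y [yC py ey]];
       apply: (unroll _ i j x y) => // xy; apply: farlz.
  - by move=> n; rewrite /U /W !modnDl.
  - by apply: pos_lt.
  - by apply: pos_lt.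
  - by apply: contraNneq ab => /pos_inj->.
  - by apply/exists_inP; exists a; rewrite // modn_small ?pos_lt ?eqxx.
  - by apply/exists_inP; exists b; rewrite // modn_small ?pos_lt ?eqxx.
have cardle : #|nbrs e C z :|: nbrs e C (last z s)| <= \sum_(0 <= n < c) (U n || W n : nat).
  have -> : nbrs e C z :|: nbrs e C (last z s) = [set x in C | e z x || e (last z s) x].
    by apply/setP=> x; rewrite !inE andb_orr.
  apply: leq_trans (card_marks _) _; apply: leq_sum => n _.
  case E: [exists _ in _, _] => //; move: E => /exists_inP[x xC /andP[px]] /orP[] zx.
    by have -> : U n by [apply/exists_inP; exists x; rewrite ?px].
  have -> : W n by apply/exists_inP; exists x; rewrite ?px.
  by rewrite orbT.
by move: gapl cardle; clear; lia.
Qed.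

(** Two distinct attachments of D can be chosen at distinct vertices of D: if both
    belong to u, then another vertex of D reaches C while avoiding u. A path of D
    between the chosen vertices is an ear of size at least 2. *)
Lemma longest_ear e D : bridge e D -> 1 < #|D| -> exists s,
  [/\ ear e D s, 1 < size s & forall s', ear e D s' -> size s' <= size s].
Proof.
move=> brD D2.
pose P n := [exists s : n.-tuple T, ear e D s].
have PE s : ear e D s -> P (size s) by move=> h; apply/existsP; exists (in_tuple s).
have [u [v [a [b [[uD vD [aC bC] ab /andP[ua vb]] uv]]]]] : exists u v a b,
    [/\ u \in D, v \in D, a \in C /\ b \in C, a != b & e u a && e v b] /\ u != v.
  have [u [v [a [b [uD vD [aC bC] ab uavb]]]]] := bridge_two brD.
  have [uv|uv] := eqVneq u v; last by exists u, v, a, b.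
  move: uavb; rewrite -{v}uv in vD * => /andP[ua ub].
  have /card_gt0P[z] : 0 < #|D :\ u| by have := cardsD1 u D; rewrite uD; lia.
  rewrite !inE => /andP[zu zD].
  have [w [x [zw xC wx]]] := bridge_avoid brD uD zD zu.
  have : w \in D :\ u by apply: inside_mem zw _; rewrite !inE zu.
  rewrite !inE => /andP[wu wD].
  have [xa|xa] := eqVneq x a.
    by exists w, u, a, b; split=> //; split=> //; rewrite -{1}xa wx.
  by exists w, u, x, a; split=> //; split=> //; rewrite wx.
have [s0 es0 s02] : exists2 s, ear e D s & 1 < size s.
  have [q [pq uq lq sD]] := inside_path (bridge_conn brD uD vD) uD.
  exists (u :: q); last by case: q lq {pq uq sD} => //= /eqP; rewrite (negbTE uv).
  apply/earP; split=> //; exists a, b; split=> //=.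
  by rewrite rcons_path lq vb pq (bridge_sym brD) ua.
have bound n : P n -> n <= #|T|.
  case/existsP=> s /earP[us _ _].
  by rewrite -(size_tuple s) -(card_uniqP us) max_card.
have exP : exists n, P n by exists (size s0); apply: PE.
have [m /existsP[s es] mx] := ex_maxnP exP bound.
exists s; split=> //.
  by rewrite size_tuple; apply: leq_trans s02 (mx _ (PE _ es0)).
by move=> s' /PE /mx; rewrite size_tuple.
Qed.

Definition common e (S : {set T}) x y := nbrs e S x :&: nbrs e S y.

(** * Longest ears of a bridge *)

Section LongestEar.
Variables (e : rel T) (D : {set T}) (s : seq T).
Hypotheses (brD : bridge e D) (es : ear e D s).
Hypothesis smax : forall s', ear e D s' -> size s' <= size s.

Let sym : symmetric e := bridge_sym brD.

(** A detour between two consecutive vertices of the ear would lengthen it. *)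
Lemma ear_insert s1 x y s2 q : s = s1 ++ x :: y :: s2 -> uniq q ->
  {subset q <= D} -> {in q, forall w, w \notin s} -> path e x (rcons q y) -> q = [::].
Proof.
move=> def_s uq qD qs pq.
suff /smax : ear e D (s1 ++ x :: q ++ y :: s2).
  by rewrite def_s !size_cat /= size_cat /=; case: q {uq qD qs pq} => //= w q; lia.
have /earP[us sD [a [b [aC bC ab ps]]]] := es; apply/earP; split.
- rewrite -cat1s catA uniq_catCA -catA -def_s cat_uniq uq us andbT /=.
  by apply/hasPn=> w; apply: contraL => /qs.
- move=> w; rewrite mem_cat inE mem_cat => h.
  have [/qD//|wq] := boolP (w \in q).
  by apply: sD; rewrite def_s mem_cat inE; move: h; rewrite (negbTE wq).
exists a, b; split=> //.
have {pq} /andP[pq qy] : path e x q && e (last x q) y by rewrite -rcons_path.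
move: ps; rewrite def_s !rcons_cat !cat_path /= => /and4P[p1 e1 exy p2].
by rewrite rcons_cat cat_path /= p1 e1 pq qy p2.
Qed.

Lemma common_on_ear s1 x y s2 : s = s1 ++ x :: y :: s2 ->
  common e D x y \subset [set w in s] :\ x :\ y.
Proof.
move=> def_s; apply/subsetP=> w; rewrite !inE => /andP[/andP[wD xw] /andP[_ yw]].
have irr := bridge_irr brD.
have -> : w != y by apply: contraTneq yw => ->; rewrite irr.
have -> : w != x by apply: contraTneq xw => ->; rewrite irr.
apply: contraT => ws; suff : [:: w] = [::] by [].
apply: (ear_insert def_s) => //.
- by move=> z; rewrite inE => /eqP->.
- by move=> z; rewrite inE => /eqP->.
- by rewrite /= xw sym yw.
Qed.

Lemma ear_uniq : uniq s. Proof. by have /earP[] := es. Qed.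
Lemma ear_sub : {subset s <= D}. Proof. by have /earP[] := es. Qed.

Lemma consecutive_neq s1 x y s2 : s = s1 ++ x :: y :: s2 -> x != y.
Proof.
move=> def_s; have := ear_uniq; rewrite def_s cat_uniq => /and3P[_ _].
by rewrite /= inE negb_or => /andP[/andP[]].
Qed.

Lemma card_ear_minus s1 x y s2 : s = s1 ++ x :: y :: s2 ->
  #|[set w in s] :\ x :\ y| = size s - 2.
Proof.
move=> def_s; have us := ear_uniq.
have cs : #|[set w in s]| = size s by rewrite cardsE; apply/card_uniqP.
have xs : x \in [set w in s] by rewrite inE def_s mem_cat !inE eqxx !orbT.
have ys : y \in [set w in s] :\ x.
  by rewrite !inE eq_sym (consecutive_neq def_s) def_s mem_cat !inE eqxx !orbT.
by have := cardsD1 x [set w in s]; have := cardsD1 y ([set w in s] :\ x); rewrite xs ys; lia.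
Qed.

(** The piece of an ear behind y leads to C. *)
Lemma tail_attached s1 x y s2 w : ear e D (s1 ++ x :: y :: s2) -> w \in s2 ->
  exists v b, [/\ connect (inside e (D :\ x :\ y)) w v, b \in C & e v b].
Proof.
case/earP=> us sD [a [b [aC bC ab ps]]] ws2.
case/splitPr: ws2 us sD ps => l1 l2 us sD ps.
have pl : path e w l2 && e (last w l2) b.
  move: ps; rewrite rcons_cat cat_path => /andP[_] /= /and3P[_ _].
  by rewrite rcons_cat cat_path rcons_cons /= rcons_path => /and3P[].
exists (last w l2), b; split=> //.
  apply: connect_path.
  - rewrite !inE sD ?mem_cat ?inE ?mem_cat ?inE ?eqxx ?orbT // andbT.
    move: us; rewrite cat_uniq => /and3P[_ _].
    rewrite /= !inE !mem_cat !inE !negb_or => /and3P[/and4P[_ _ xw _] /and3P[_ yw _] _].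
    by rewrite eq_sym yw eq_sym xw.
  - move=> v vl; rewrite !inE sD ?mem_cat ?inE ?mem_cat ?inE ?vl ?orbT // andbT.
    move: us; rewrite cat_uniq => /and3P[_ _].
    rewrite /= !inE !mem_cat !inE !negb_or => /and3P[/and4P[_ _ _ xl] /and3P[_ _ yl] _].
    by apply/andP; split; [apply: contraNneq yl | apply: contraNneq xl] => <-.
  - by case/andP: pl.
by case/andP: pl.
Qed.

Lemma ear_rev s' : ear e D s' -> ear e D (rev s').
Proof.
case/earP=> us sD [a [b [aC bC ab ps]]]; apply/earP; rewrite rev_uniq; split=> //.
  by move=> x; rewrite mem_rev; apply: sD.
by exists b, a; rewrite eq_sym -path_rev.
Qed.

(** This is what makes the contraction of the edge xy preserve [bridge_avoid]. If
    {x, y} separated a part F of D from C, then F would be joined to both x and y,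
    because neither of them separates alone. A path through F from x to y would be
    a detour: F is disjoint from the ear, whose two remaining pieces reach C without
    x and y. *)
Lemma ear_contractible s1 x y s2 : s = s1 ++ x :: y :: s2 ->
  {in D, forall z, z != x -> z != y ->
    exists v b, [/\ connect (inside e (D :\ x :\ y)) z v, b \in C & e v b]}.
Proof.
move=> def_s z zD zx zy.
have xs : x \in s by rewrite def_s mem_cat !inE eqxx !orbT.
have ys : y \in s by rewrite def_s mem_cat !inE eqxx !orbT.
have xy := consecutive_neq def_s.
set D' := D :\ x :\ y.
have swap : D :\ y :\ x = D' by rewrite /D' !setDDl setUC.
have [|none] := boolP [exists v, exists b, [&& connect (inside e D') z v, b \in C & e v b]].
  by case/existsP=> v /existsP[b /and3P[? ? ?]]; exists v, b.
have {}none v b : connect (inside e D') z v -> b \in C -> e v b -> False.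
  move=> zv bC vb; case/negP: none; apply/existsP; exists v; apply/existsP; exists b.
  by rewrite zv bC.
exfalso.
have half u w : u \in D -> w \in D -> u != w -> z != u -> z != w -> D :\ u :\ w = D' ->
    exists2 v, connect (inside e D') z v & e v w.
  move=> uD wD uw zu zw defD; have [v [b [zv bC vb]]] := bridge_avoid brD uD zD zu.
  have zw' : z \notin [set w] by rewrite inE.
  case: (avoid_or_hit zv zw'); rewrite -/(D :\ u :\ w) defD; first by move=> /none/(_ bC)/(_ vb).
  by case=> v' [w' [zv' /setIP[_ /set1P->] v'w]]; exists v'.
have [w1 zw1 w1y] := half x y (ear_sub xs) (ear_sub ys) xy zx zy erefl.
have [w2 zw2 w2x] : exists2 v, connect (inside e D') z v & e v x.
  by apply: (half y x); rewrite ?ear_sub // eq_sym.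
have w2D : w2 \in D' by apply: inside_mem zw2 _; rewrite !inE zx zy.
have [|q [pq uq lq qD]] := @inside_path _ e D' w2 w1 _ w2D.
  by apply: connect_trans zw1; rewrite (inside_sym _ sym).
suff : w2 :: q = [::] by [].
apply: (ear_insert def_s) => //.
- by move=> w /qD; rewrite !inE => /and3P[].
- move=> w wq; apply/negP=> ws; have wD' := qD w wq.
  have zw : connect (inside e D') z w.
    by apply: connect_trans zw2 (connect_path_mem _ pq wq).
  have [ws2|ws1] : w \in s2 \/ w \in rev s1.
    move: wD' ws; rewrite !inE mem_rev def_s mem_cat !inE => /and3P[/negbTE-> /negbTE-> _] /=.
    by move/orP=> [] ->; [right|left].
  + have [v [b [wv bC vb]]] := tail_attached (s1 := s1) (x := x) (y := y) (s2 := s2) (w := w)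
      ltac:(by rewrite -def_s) ws2.
    exact: (none v b (connect_trans zw wv) bC vb).
  (* By reversal, the piece before x is treated as the piece after y. *)
  + have er : ear e D (rev s2 ++ y :: x :: rev s1).
      have := ear_rev es; rewrite def_s rev_cat !rev_cons -!cats1 -!catA /=; exact.
    have [v [b [wv bC vb]]] := tail_attached er ws1.
    by rewrite swap in wv; apply: (none v b (connect_trans zw wv) bC vb).
- by rewrite /= sym w2x rcons_path pq lq w1y.
Qed.

End LongestEar.

(** * Longest ears with many common neighbours *)

(** The case in which the contraction of an edge of a longest ear s would lose too
    many edges, whatever edge of s is chosen. Common neighbours in D are on s, so
    consecutive vertices of s have at least [quota] common attachments. On the other
    hand the ends have at most [quota] attachments together. So there is equality
    everywhere: s is a clique, all its vertices have exactly [quota] attachments, and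
    s is all of D. *)
Section DenseEar.
Variables (e : rel T) (D : {set T}) (s : seq T).
Hypotheses (brD : bridge e D) (es : ear e D s).
Hypothesis smax : forall s', ear e D s' -> size s' <= size s.
Hypothesis s2 : 1 < size s.
Hypothesis dense : forall s1 x y s2, s = s1 ++ x :: y :: s2 ->
  c./2 <= (#|common e D x y| + #|common e C x y|).+1.

Let sym : symmetric e := bridge_sym brD.
Let N := nbrs e C.
(** For a path with size s vertices this is the bound of [ear_ends_bound] on the
    number of attachments of its ends. *)
Let quota := c./2 + 1 - size s.

Let sD : {subset s <= D} := ear_sub es.
Let us : uniq s := ear_uniq es.

Lemma dense_ends z q a b : uniq (z :: q) -> {subset z :: q <= D} -> path e z q ->
  size q = (size s).-1 -> a \in N z -> b \in N (last z q) -> a != b ->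
  #|N z :|: N (last z q)| <= quota.
Proof.
move=> uz zD pz sz; rewrite !inE => /andP[aC za] /andP[bC zb] ab.
have := ear_ends_bound brD uz zD pz aC bC ab za zb.
by rewrite sz /quota -/N; clear; lia.
Qed.

Lemma quota_ge2 : 2 <= quota.
Proof.
have [_ _ [a [b [aC bC ab ps]]]] := earP _ _ _ es.
case def_s: s ps => [|z q]; first by move: s2; rewrite def_s.
rewrite /= rcons_path => /and3P[az pq zb].
have h : #|N z :|: N (last z q)| <= quota.
  apply: (@dense_ends z q a b) => //.
  - by rewrite -def_s.
  - by move=> w; rewrite -def_s; apply: sD.
  - by rewrite def_s.
  - by rewrite inE aC sym.
  - by rewrite inE bC.
have c2 : #|[set a; b]| = 2 by rewrite cards2 ab.
apply: leq_trans h; rewrite -c2.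
apply: subset_leq_card; apply/subsetP=> w.
by rewrite !inE => /orP[] /eqP->; rewrite ?aC ?bC /= ?zb ?orbT // sym az.
Qed.

Lemma common_ge s1 x y s3 : s = s1 ++ x :: y :: s3 -> quota <= #|common e C x y|.
Proof.
move=> def_s; have := subset_leq_card (common_on_ear brD es smax def_s).
rewrite (card_ear_minus es def_s); have := dense def_s; have := quota_ge2.
by move: s2; rewrite /quota; clear; lia.
Qed.

Lemma common_nbrs x y : common e C x y \subset N x /\ common e C x y \subset N y.
Proof. by rewrite subsetIl subsetIr. Qed.

Lemma consecutive_full s1 x y s3 : s = s1 ++ x :: y :: s3 -> #|N x| <= quota \/ #|N y| <= quota ->
  {in s, forall w, w != x -> w != y -> e x w /\ e y w}.
Proof.
move=> def_s Nxy w ws wx wy.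
have [cx cy] := common_nbrs x y.
have le : #|common e C x y| <= quota.
  by case: Nxy; apply: leq_trans; apply: subset_leq_card.
have : common e D x y == [set w in s] :\ x :\ y.
  rewrite eqEcard (common_on_ear brD es smax def_s) (card_ear_minus es def_s).
  by have := dense def_s; have := quota_ge2; move: le s2; rewrite /quota; clear; lia.
move/eqP/setP/(_ w); rewrite !inE ws wx wy /=.
by move/andP=> [/andP[_ ->] /andP[_ ->]].
Qed.

Lemma ends_attachments z q : s = z :: q -> #|N z| <= quota /\ N (last z q) = N z.
Proof.
move=> def_s.
have [_ _ [a [b [aC bC ab ps]]]] := earP _ _ _ es.
have {ps} : e z a /\ path e z q /\ e (last z q) b.
  by move: ps; rewrite def_s /= rcons_path sym => /and3P[].
move=> [za [pq zb]].
have h : #|N z :|: N (last z q)| <= quota.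
  apply: (@dense_ends z q a b) => //.
  - by rewrite -def_s.
  - by move=> w; rewrite -def_s; apply: sD.
  - by rewrite def_s.
  - by rewrite inE aC.
  - by rewrite inE bC.
have sU : N z \subset N z :|: N (last z q) by apply: subsetUl.
have sW : N (last z q) \subset N z :|: N (last z q) by apply: subsetUr.
have Nz : quota <= #|N z|.
  case: q def_s {pq zb h sU sW} => [|y q] def_s; first by move: s2; rewrite def_s.
  have /common_ge h : s = [::] ++ z :: y :: q by [].
  by apply: leq_trans h (subset_leq_card _); case: (common_nbrs z y).
have Nl : quota <= #|N (last z q)|.
  case/lastP: q def_s {pq zb h sU sW} => [|q l] def_s; first by move: s2; rewrite def_s.
  rewrite last_rcons; case/lastP: q def_s => [|q y] def_s.
    have /common_ge h : s = [::] ++ z :: l :: [::] by [].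
    by apply: leq_trans h (subset_leq_card _); case: (common_nbrs z l).
  have /common_ge h : s = (z :: q) ++ y :: l :: [::] by rewrite def_s /= -!cats1 -catA.
  by apply: leq_trans h (subset_leq_card _); case: (common_nbrs y l).
have Ez : N z == N z :|: N (last z q) by rewrite eqEcard sU (leq_trans h).
have El : N (last z q) == N z :|: N (last z q) by rewrite eqEcard sW (leq_trans h).
split; first exact: leq_trans (subset_leq_card sU) h.
by rewrite (eqP El) -(eqP Ez).
Qed.

(** The first vertex z of the ear is adjacent to all the others. So if x is followed
    by y, the ear can be rearranged as x ... z y ..., which turns the inner vertex x
    into an end. *)
Lemma attachments_le s1 x y s3 : s = s1 ++ x :: y :: s3 -> #|N x| <= quota.
Proof.
case: s1 => [|z s1] def_s; first by have [] := ends_attachments def_s.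
have [Nz Nl] := ends_attachments def_s.
have ys : y \in s by rewrite def_s mem_cat !inE eqxx !orbT.
have zy : e z y.
  case: s1 def_s {Nl} => [|u s1] def_s.
    have zs : s = [::] ++ z :: x :: y :: s3 by [].
    have := us; rewrite def_s /= !inE !negb_or => /and3P[/and3P[_ zy _] /andP[xy _] _].
    by case: (consecutive_full zs (or_introl Nz) ys); rewrite // eq_sym.
  have zs : s = [::] ++ z :: u :: (s1 ++ x :: y :: s3) by [].
  have := us; rewrite def_s /= !mem_cat !inE !mem_cat !inE !negb_or.
  case/and3P=> /and4P[_ _ _ /andP[zy _]] /and3P[_ _ /andP[uy _]] _.
  by case: (consecutive_full zs (or_introl Nz) ys); rewrite // eq_sym.
have [cx _] := common_nbrs x y.
have Nx : quota <= #|N x| by apply: leq_trans (common_ge def_s) (subset_leq_card cx).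
have [b bN] : exists b, b \in N (last y s3).
  have -> : N (last y s3) = N z by rewrite -Nl last_cat.
  apply/card_gt0P; have [_ h] := common_nbrs z z.
  case: s1 def_s {Nl Nz} => [|u s1] def_s.
    have /common_ge : s = [::] ++ z :: x :: y :: s3 by [].
    move/leq_trans/(_ (subset_leq_card (proj1 (common_nbrs _ _)))).
    by apply: leq_trans; have := quota_ge2; lia.
  have /common_ge : s = [::] ++ z :: u :: (s1 ++ x :: y :: s3) by [].
  move/leq_trans/(_ (subset_leq_card (proj1 (common_nbrs _ _)))).
  by apply: leq_trans; have := quota_ge2; lia.
have [a aN ab] : exists2 a, a \in N x & a != b.
  have : 0 < #|N x :\ b|.
    by have := cardsD1 b (N x); have := quota_ge2; move: Nx; case: (b \in N x); clear; lia.
  by case/card_gt0P=> a; rewrite in_setD1 => /andP[? ?]; exists a.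
(* The piece before x backwards, then the unchanged piece from y on. *)
pose q := rev (z :: s1) ++ y :: s3.
have lq : last x q = last y s3 by rewrite last_cat.
have perm : perm_eq (x :: q) s.
  by rewrite def_s /q -cat1s perm_catCA; apply: perm_cat; rewrite // perm_rev.
apply: leq_trans (@dense_ends x q a b _ _ _ _ aN _ ab); rewrite ?lq //.
- exact: subset_leq_card (subsetUl _ _).
- by rewrite (perm_uniq perm).
- by move=> w; rewrite (perm_mem perm); apply: sD.
- have [_ _ [a' [b' [_ _ _ ps]]]] := earP _ _ _ es.
  move: ps; rewrite def_s rcons_cat cat_path /= => /andP[/andP[_ p1] /and3P[lx _ p2]].
  rewrite rcons_path in p2; case/andP: p2 => p2 _.
  by rewrite /q rev_cons cat_path last_rcons /= zy p2 path_rev // revK rcons_path p1 lx.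
- by have := perm_size perm => /= <-.
Qed.

Lemma mem_consecutive u : u \in s -> exists s1 x y s3,
  s = s1 ++ x :: y :: s3 /\ (u = x \/ u = y /\ s3 = [::]).
Proof.
move=> us'; have := erefl s; case/splitPr: {2}s / us' => p1 [|y p2] def_s; last first.
  by exists p1, u, y, p2; split; [|left].
case/lastP: p1 def_s => [|p1 x] def_s; first by move: s2; rewrite def_s.
by exists p1, x, u, [::]; rewrite def_s -cats1 -catA; split; [|right].
Qed.

Lemma card_nbrs_dense u : u \in s -> #|N u| = quota.
Proof.
case/mem_consecutive=> s1 [x [y [s3 [def_s]]]].
have [cx cy] := common_nbrs x y; have cm := common_ge def_s.
case=> [->|[-> def_s3]]; apply/eqP; rewrite eqn_leq.
  by rewrite (attachments_le def_s) (leq_trans cm (subset_leq_card cx)).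
rewrite (leq_trans cm (subset_leq_card cy)) andbT.
case: s1 def_s => [|z s1] /= def_s; have [Nz Nl] := ends_attachments def_s.
  by move: Nl; rewrite /= def_s3 /= => ->.
by move: Nl; rewrite last_cat /= def_s3 /= => ->.
Qed.

Lemma dense_clique : {in s &, forall u w, u != w -> e u w}.
Proof.
move=> u w us' ws uw; have [s1 [x [y [s3 [def_s hu]]]]] := mem_consecutive us'.
have full := consecutive_full def_s (or_introl (attachments_le def_s)) ws.
have xy : e x y.
  have [_ _ [a [b [_ _ _ ps]]]] := earP _ _ _ es.
  by move: ps; rewrite def_s rcons_cat cat_path /= => /and4P[].
case: hu uw full => [->|[-> _]] uw full.
  by have [->|wy] := eqVneq w y; [|case: full; rewrite // eq_sym].
by have [->|wx] := eqVneq w x; [rewrite sym|case: full; rewrite // eq_sym].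
Qed.

Lemma clique_ear u q : uniq (u :: q) -> {subset u :: q <= D} -> path e u q ->
  u \in s -> 0 < #|N (last u q)| -> ear e D (u :: q).
Proof.
move=> uq qD pq us' /card_gt0P[b]; rewrite inE => /andP[bC lb].
have : 0 < #|N u :\ b|.
  have := cardsD1 b (N u); rewrite card_nbrs_dense //; have := quota_ge2.
  by case: (b \in N u); clear; lia.
case/card_gt0P=> a; rewrite !inE => /and3P[ab aC ua].
apply/earP; split=> //; exists a, b; split=> //=.
by rewrite sym ua rcons_path pq lb.
Qed.

(** A vertex outside s adjacent to z1 on s reaches C while avoiding z1. Follow it
    to its first vertex on s or to C. In both cases a longer ear results, because the
    vertices of the clique s can be visited in any order and each of them has at
    least two attachments. *)
Lemma dense_cover : {subset D <= s}.
Proof.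
move=> d dD; apply: contraT => ds.
pose S := [set x in s].
have memS x : (x \in S) = (x \in s) by rewrite inE.
have [z zs] : exists z, z \in s by case: s s2 => // z q _; exists z; rewrite mem_head.
have [w [z1 [dw /setIP[z1D]]]] : exists w b,
    [/\ connect (inside e (D :\: S)) d w, b \in D :&: S & e w b].
  have dS : d \notin S by rewrite memS.
  case: (avoid_or_hit (bridge_conn brD dD (sD zs)) dS) => // dz.
  have : z \in D :\: S by apply: inside_mem dz _; rewrite in_setD dS.
  by rewrite in_setD memS zs.
rewrite memS => z1s wz1.
have : w \in D :\: S by apply: inside_mem dw _; rewrite in_setD memS ds.
rewrite in_setD => /andP[wS wD].
have z1w : e z1 w by rewrite sym.
have wz1' : w != z1 by apply: contraNneq wS => ->; rewrite memS.
have [v [b [wv bC vb]]] := bridge_avoid brD z1D wD wz1'.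
pose r := filter (predC1 z1) s.
have rs x : (x \in r) = (x != z1) && (x \in s) by rewrite mem_filter.
have sz_r : size r = (size s).-1.
  by rewrite /r -(rem_filter z1 us) size_rem.
have w'D : w \in D :\ z1 :\: S by rewrite in_setD wS in_setD1 wz1' wD.
case: (avoid_or_hit wv wS) => [wv'|[w2 [z2 [ww2 /setIP[]]]]].
  (* The walk reaches C without meeting s: visit all of s first, z1 last. *)
  have [q [pq uq lq qD]] := inside_path wv' w'D.
  case def_r: r => [|u r']; first by move: s2; rewrite -ltn_predRL -sz_r def_r.
  have us' : u \in s by have := rs u; rewrite def_r mem_head => /esym/andP[].
  have rsub : {subset u :: rcons r' z1 <= s}.
    move=> x; rewrite -rcons_cons -def_r mem_rcons inE rs.
    by case/predU1P=> [->|/andP[]].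
  have ur : uniq (u :: rcons r' z1).
    by rewrite -rcons_cons -def_r rcons_uniq rs eqxx /= filter_uniq.
  have /smax : ear e D (u :: rcons r' z1 ++ w :: q).
    apply: clique_ear => //.
    - rewrite -cat_cons cat_uniq ur uq andbT /=; apply/norP; split.
        by apply/negP=> /rsub; apply/negP; rewrite -memS.
      apply/hasPn=> x xq; apply/negP=> /rsub.
      have : x \in D :\ z1 :\: S by apply: qD; rewrite inE xq orbT.
      by rewrite in_setD memS => /andP[/negP].
    - move=> x; rewrite -cat_cons mem_cat => /orP[/rsub/sD//|/qD].
      by rewrite !inE => /and3P[].
    - rewrite cat_path last_rcons /= z1w pq !andbT.
      exact: (clique_path dense_clique ur rsub).
    - rewrite last_cat last_rcons /= lq; apply/card_gt0P; exists b.
      by rewrite inE bC.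
  by rewrite -cat_cons size_cat -rcons_cons -def_r size_rcons sz_r /=; clear; lia.
rewrite in_setD1 memS => /andP[z21 z2D] z2s w2z2.
(* The walk comes back to s at z2: go from z1 to z2 outside s, then visit the rest. *)
have [q [pq uq lq qD]] := inside_path ww2 w'D.
pose r2 := filter (predC1 z2) r.
have sz_r2 : size r2 = (size s).-2.
  rewrite /r2 -rem_filter ?filter_uniq // size_rem ?sz_r // rs z21 z2s //.
have z2r : uniq (z2 :: r2).
  by rewrite /= mem_filter /= eqxx /= !filter_uniq.
have r2s : {subset z2 :: r2 <= s}.
  by move=> x; rewrite inE mem_filter rs => /predU1P[->|/and3P[]].
have /smax : ear e D (z1 :: (w :: q) ++ z2 :: r2).
  have z1not : z1 \notin (w :: q) ++ z2 :: r2.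
    have z1r : z1 \notin z2 :: r2.
      by rewrite inE eq_sym (negbTE z21) mem_filter rs eqxx /= andbF.
    rewrite mem_cat negb_or z1r andbT.
    by apply/negP=> /qD; rewrite !inE eqxx andbF.
  apply: clique_ear => //.
  - rewrite cons_uniq z1not cat_uniq uq z2r andbT.
    apply/hasPn=> x /r2s xs; apply/negP=> /qD; rewrite in_setD memS xs //.
  - move=> x; rewrite inE mem_cat => /predU1P[->//|/orP[/qD|/r2s/sD//]].
    by rewrite !inE => /and3P[].
  - rewrite /= z1w cat_path pq lq /= w2z2.
    exact: (clique_path dense_clique z2r r2s).
  - rewrite last_cat /= card_nbrs_dense ?r2s ?mem_last //.
    by have := quota_ge2; clear; lia.
by rewrite /= size_cat /= sz_r2; clear; lia.
Qed.

Lemma dense_weight : weight e D <= (2 * c./2).-1 * #|D|.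
Proof.
have cD : #|D| = size s.
  rewrite -(card_uniqP us); apply: eq_card => x.
  by apply/idP/idP; [apply: dense_cover | apply: sD].
have h1 : darts e D D <= #|D| * (size s).-1.
  by rewrite -cD; apply: darts_irr_le; apply: bridge_irr brD.
have h2 : darts e D C = #|D| * quota.
  rewrite dartsE -sum_nat_const; apply: eq_bigr => u /dense_cover.
  exact: card_nbrs_dense.
rewrite /weight h2; apply: leq_trans (leq_add h1 (leqnn _)) _.
rewrite mulnCA -mulnDr mulnC leq_mul2r; apply/orP; right.
by have := quota_ge2; move: s2; rewrite /quota; clear; lia.
Qed.

End DenseEar.

(** * Contracting an edge of a bridge *)

Section Contract.
Variables (e : rel T) (D : {set T}) (x y : T).
Hypotheses (brD : bridge e D) (xD : x \in D) (yD : y \in D) (xy : e x y).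

Let sym : symmetric e := bridge_sym brD.
Let irr : irreflexive e := bridge_irr brD.

(** The edge xy is contracted to x. The vertex y keeps stale adjacencies, but it is
    removed from D. *)
Definition contract : rel T := fun u v =>
  if u == x then (v != x) && (e x v || e y v)
  else if v == x then e x u || e y u else e u v.

Let merge z := if z == y then x else z.

Let neq_xy : x != y.
Proof. by apply: contraTneq xy => ->; rewrite irr. Qed.

Let notC u b : u \in D -> b \in C -> b != u.
Proof.
move=> uD bC; apply: contraTneq uD => <-.
by rewrite (disjointFl (bridge_disj brD) bC).
Qed.

Lemma contract_sym : symmetric contract.
Proof.
move=> u v; rewrite /contract.
by case: (u == x); case: (v == x); rewrite //= sym.
Qed.

Lemma contract_irr : irreflexive contract.
Proof. by move=> u; rewrite /contract irr; case: eqP. Qed.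

Lemma contract_old u v : u != x -> v != x -> contract u v = e u v.
Proof. by move=> /negbTE ux /negbTE vx; rewrite /contract ux vx. Qed.

Lemma contract_step u v : e u v -> merge u != merge v -> contract (merge u) (merge v).
Proof.
move=> uv; rewrite /merge /contract.
case: (eqVneq u y) uv => [->|uy] uv; case: (eqVneq v y) uv => [->|vy] uv.
- by rewrite eqxx.
- by rewrite eqxx eq_sym => ->; rewrite uv orbT.
- by move/negbTE=> ->; rewrite eqxx sym [e y _]sym uv orbT.
case: (eqVneq u x) uv => [->|ux] uv; case: (eqVneq v x) uv => [->|vx] uv //.
  by rewrite uv.
by rewrite sym uv.
Qed.

Lemma contract_attach v b : e v b -> b \in C -> contract (merge v) b.
Proof.
move=> vb bC; have bx := notC xD bC; have by' := notC yD bC.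
have := contract_step vb; rewrite /merge (negbTE by'); case: ifP => [_|_]; apply.
  by rewrite eq_sym.
by apply: contraNneq (negbT (bridge_irr brD b)) => vb'; rewrite -{1}vb'.
Qed.

Lemma contract_connect (A : {set T}) u v : x \in A ->
  connect (inside e A) u v -> connect (inside contract (A :\ y)) (merge u) (merge v).
Proof.
move=> xA; apply: connect_hom => a b /and3P[aA bA ab].
have mA z : z \in A -> merge z \in A :\ y.
  rewrite /merge; case: eqVneq => [_ _|zy zA]; rewrite !inE ?zy //.
  by rewrite neq_xy.
have [->|ne] := eqVneq (merge a) (merge b); first exact: connect0.
by apply: connect1; rewrite /inside !mA //= contract_step.
Qed.

Lemma contract_entry l : l != x -> contract l x ->
  exists2 u, (u == x) || (u == y) & e l u.
Proof.
move=> lx; rewrite contract_sym /contract eqxx lx /= sym [e y _]sym.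
by case/orP=> h; [exists x | exists y]; rewrite ?eqxx ?orbT.
Qed.

Lemma contract_exit q : x \notin q -> path contract x q -> q <> [::] ->
  exists2 v, (v == x) || (v == y) & path e v q.
Proof.
case: q => // h q; rewrite inE negb_or eq_sym => /andP[hx xq] /= /andP[xh pq] _.
have pq' : path e h q.
  rewrite -(eq_in_path (P := predC1 x) (e := contract)) //.
  - by move=> u v; rewrite !inE => ux vx; apply: contract_old.
  - rewrite /= hx; apply/allP=> u uq; rewrite !inE.
    by apply: contraNneq xq => <-.
move: xh; rewrite contract_sym => /(contract_entry hx)[v vxy hv].
by exists v; rewrite //= sym hv.
Qed.

Hypothesis contractible : {in D, forall z, z != x -> z != y ->
    exists v b, [/\ connect (inside e (D :\ x :\ y)) z v, b \in C & e v b]}.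

(** A path through the contracted vertex lifts to a path through x, through y, or
    through both, hence to one that is at least as long. *)
Lemma contract_far a b s : a \in C -> b \in C -> a != b -> uniq s ->
  {subset s <= D :\ y} -> path contract a (rcons s b) -> far (size s) (pos a) (pos b).
Proof.
move=> aC bC ab us sD ps; have ax := notC xD aC; have bx := notC xD bC.
have sD' : {subset s <= D} by move=> u /sD; rewrite in_setD1 => /andP[].
have [xs|xs] := boolP (x \in s); last first.
  apply: (bridge_far brD) => //.
  rewrite -(eq_in_path (P := predC1 x) (e := contract)) //.
  - by move=> u v; rewrite !inE => ux vx; apply: contract_old.
  - rewrite /= ax all_rcons /= bx; apply/allP=> u uq; rewrite !inE.
    by apply: contraNneq xs => <-.
have ys : y \notin s by apply/negP=> /sD; rewrite !inE eqxx.
case/splitPr: xs us sD sD' ys ps => s1 s2 us sD sD' ys.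
have xs1 : x \notin s1.
  by move: us; rewrite uniq_catC /= mem_cat negb_or => /andP[/andP[]].
have xs2 : x \notin s2.
  by move: us; rewrite uniq_catC /= mem_cat negb_or => /andP[/andP[]].
have us12 : uniq (s1 ++ s2).
  by move: us; rewrite uniq_catC /= => /andP[_]; rewrite uniq_catC.
have [ys1 ys2] : y \notin s1 /\ y \notin s2.
  by move: ys; rewrite mem_cat inE !negb_or => /and3P[].
rewrite rcons_cat cat_path /= => /and3P[p1 lx p2].
have lx' : last a s1 != x.
  have := mem_last a s1; rewrite inE => /predU1P[->//|].
  by apply: contraTneq => ->.
have [u uxy lu] := contract_entry lx' lx.
have [||v vxy pv] := @contract_exit (rcons s2 b) _ p2.
- by rewrite mem_rcons inE negb_or eq_sym bx.
- by case: (s2).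
have p1' : path e a s1.
  rewrite -(eq_in_path (P := predC1 x) (e := contract)) //.
  - by move=> z w; rewrite !inE => zx wx; apply: contract_old.
  - rewrite /= ax; apply/allP=> z zq; rewrite !inE.
    by apply: contraNneq xs1 => <-.
(* The path enters the contracted edge at u and leaves it at v. *)
pose mid := if u == v then [:: u] else [:: u; v].
have mid_mem w : w \in mid -> (w == x) || (w == y).
  by rewrite /mid; case: ifP => _; rewrite !inE; [move/eqP->|case/orP=> /eqP->].
have pmid : path e a (rcons (s1 ++ mid ++ s2) b).
  rewrite !rcons_cat cat_path p1' /mid; case: eqVneq => [uv|uv] /=.
    by rewrite lu uv pv.
  rewrite lu pv /= andbT.
  case/orP: uxy uv => /eqP->; case/orP: vxy => /eqP->; rewrite ?eqxx //.
  by rewrite sym.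
have : far (size (s1 ++ mid ++ s2)) (pos a) (pos b).
  apply: (bridge_far brD) => //.
    rewrite uniq_catCA cat_uniq us12 andbT; apply/andP; split.
      by rewrite /mid; case: eqVneq => //= uv; rewrite inE uv.
    apply/hasPn=> w; rewrite mem_cat; apply: contraL => /mid_mem /orP[] /eqP->;
    by apply/norP.
  move=> w; rewrite !mem_cat => /or3P[ws|/mid_mem/orP[] /eqP->//|ws];
    by apply: sD'; rewrite mem_cat ?inE ws ?orbT.
rewrite /far !size_cat /= /mid; case: ifP => _ /=; clear; lia.
Qed.

Lemma bridge_contract : bridge contract (D :\ y).
Proof.
have merge_old z : z != y -> merge z = z by rewrite /merge => /negbTE->.
have mergeD z : z \in D -> merge z \in D :\ y.
  rewrite /merge; case: eqVneq => [_ _|zy zA]; rewrite !inE ?zy //.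
  by rewrite neq_xy.
split.
- exact: contract_sym.
- exact: contract_irr.
- by apply: disjointWl (bridge_disj brD); apply: subsetDl.
- move=> u v; rewrite !inE => /andP[uy uD] /andP[vy vD].
  by have := contract_connect xD (bridge_conn brD uD vD); rewrite !merge_old.
- move=> w z; rewrite !inE => /andP[wy wD] /andP[zy zD] zw.
  have [wx|wx] := eqVneq w x.
    have [v [b [zv bC vb]]] := contractible zD (eq_ind _ (fun t => z != t) zw _ wx) zy.
    exists v, b; have : v \in D :\ x :\ y by apply: inside_mem zv _; rewrite !inE zy zD -wx zw.
    rewrite !inE => /and3P[_ vx _]; split=> //; last by rewrite contract_old // notC.
    rewrite wx (_ : D :\ y :\ x = D :\ x :\ y); last by rewrite !setDDl setUC.
    apply: (@connect_hom _ _ _ _ id) zv => p q /and3P[pD qD pq]; apply: connect1.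
    rewrite /inside pD qD contract_old //; first by move: pD; rewrite !inE => /and3P[].
    by move: qD; rewrite !inE => /and3P[].
  have [v [b [zv bC vb]]] := bridge_avoid brD wD zD zw.
  exists (merge v), b; split=> //; last exact: contract_attach.
  have xDw : x \in D :\ w by rewrite !inE eq_sym wx.
  have := contract_connect xDw zv; rewrite merge_old //.
  by rewrite (_ : D :\ w :\ y = D :\ y :\ w) // !setDDl setUC.
- have [u [v [a [b [uD vD [aC bC] ab /andP[ua vb]]]]]] := bridge_two brD.
  by exists (merge u), (merge v), a, b; rewrite !mergeD // !contract_attach.
- exact: contract_far.
Qed.

(** The edge xy disappears, and the two edges to each common neighbour become one. *)
Lemma weight_contract : weight e D =
  weight contract (D :\ y) + 2 * (1 + #|common e D x y| + #|common e C x y|).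
Proof.
pose D0 := D :\ x :\ y.
have yDx : y \in D :\ x by rewrite !inE eq_sym neq_xy.
have ynot : y \notin D0 by rewrite !inE eqxx.
have xnot : x \notin y |: D0 by rewrite !inE eqxx andbF orbF.
have xnot0 : x \notin D0 by rewrite !inE eqxx andbF.
have defD : D = x |: (y |: D0) by rewrite !setD1K.
have defDy : D :\ y = x |: D0.
  by rewrite /D0 (_ : D :\ x :\ y = D :\ y :\ x) ?setD1K // ?setDDl 1?setUC // !inE neq_xy.
have card_common (S : {set T}) : #|common e S x y| = \sum_(v in S) (e x v && e y v : nat).
  rewrite -sum1_card big_mkcond [RHS]big_mkcond /=; apply: eq_bigr => v _.
  by rewrite !inE; case: (v \in S) => //=; case: (e x v); case: (e y v).
have or_and (S : {set T}) : \sum_(v in S) (e x v : nat) + \sum_(v in S) (e y v : nat) =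
    \sum_(v in S) (e x v || e y v : nat) + \sum_(v in S) (e x v && e y v : nat).
  by rewrite -!big_split; apply: eq_bigr => v _ /=; case: (e x v); case: (e y v).
have commonD : #|common e D x y| = \sum_(v in D0) (e x v && e y v : nat).
  rewrite card_common defD big_setU1 //= big_setU1 //= !irr /= andbF /=.
  by [].
have old : {in D0, forall v, v != x} by move=> v; rewrite !inE => /and3P[].
have newx (S : {set T}) : {in S, forall v, v != x} ->
    \sum_(v in S) (contract x v : nat) = \sum_(v in S) (e x v || e y v : nat).
  by move=> h; apply: eq_bigr => v vS; rewrite /contract eqxx (h v vS).
have Cx : {in C, forall v, v != x} by move=> v; apply: notC.
have new0 (S : {set T}) : {in S, forall v, v != x} -> darts contract D0 S = darts e D0 S.
  by move=> h; apply: eq_darts => u v /old ux /h vx; rewrite contract_old.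
have dx (S : {set T}) : darts e (x |: (y |: D0)) S =
    \sum_(v in S) (e x v : nat) + (\sum_(v in S) (e y v : nat) + darts e D0 S).
  by rewrite /darts !big_setU1.
have dx' (S : {set T}) : darts contract (x |: D0) S =
    \sum_(v in S) (contract x v : nat) + darts contract D0 S.
  by rewrite /darts !big_setU1.
rewrite commonD /weight defDy (dx' C).
rewrite (darts_setU1 contract_sym contract_irr) //.
rewrite {1 2 3}defD (dx C) !darts_setU1 // big_setU1 //= xy !newx // !new0 // card_common.
by have := or_and D0; have := or_and C; clear; lia.
Qed.

End Contract.

(** * The edge bound for a bridge *)

Lemma consecutive_or (P : rel T) s :
  (exists s1 x y s2, s = s1 ++ x :: y :: s2 /\ P x y) \/
  (forall s1 x y s2, s = s1 ++ x :: y :: s2 -> ~~ P x y).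
Proof.
elim: s => [|a s IH]; first by right; case.
case: IH => [[s1 [x [y [s2 [-> Pxy]]]]]|none]; first by left; exists (a :: s1), x, y, s2.
case: s none => [|b s] none; first by right=> -[|? []].
have [Pab|nPab] := boolP (P a b); first by left; exists [::], a, b, s.
by right=> -[|a' s1] x y s2 [] => [<- <- _|_ /none].
Qed.

(** The induction stops at two vertices, because a single vertex may have c./2
    attachments, which exceeds the bound. Each of the two vertices has at most c./2 - 1 attachments. *)
Lemma bridge2_weight e D : bridge e D -> #|D| = 2 -> weight e D <= (2 * c./2).-1 * #|D|.
Proof.
move=> brD D2; have sym := bridge_sym brD.
have [s [es s2 smax]] := longest_ear brD (eq_leq (esym D2)).
have [us sD [a [b [aC bC ab ps]]]] := earP _ _ _ es.
have sz : size s = 2.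
  apply/eqP; rewrite eqn_leq s2 andbT -D2 -(card_uniqP us).
  by apply: subset_leq_card; apply/subsetP.
case: s sz {s2 smax es} us sD ps => [|x [|y []]] // _ us sD /= /and4P[ax xy yb _].
have defD : D = [set x; y].
  apply/esym/eqP; rewrite eqEcard D2 cards2.
  move: us; rewrite /= inE andbT => ->; rewrite andbT.
  by apply/subsetP=> z; rewrite !inE => h; apply: sD; rewrite !inE.
have := @ear_ends_bound e D x [:: y] a b brD us sD.
rewrite /= xy sym => /(_ isT aC bC ab ax yb).
have h1 : darts e D D <= #|D| * #|D|.-1 := darts_irr_le _ (bridge_irr brD).
have h2 : darts e D C <= #|D| * #|nbrs e C x :|: nbrs e C y|.
  rewrite dartsE -sum_nat_const; apply: leq_sum => u.
  rewrite defD !inE => /orP[] /eqP->; apply: subset_leq_card.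
    exact: subsetUl.
  exact: subsetUr.
move: h1 h2; rewrite /weight D2; clear; lia.
Qed.

(** At most c./2 - 1/2 edges per vertex. If two consecutive vertices of a longest ear
    have at most c./2 - 2 common neighbours, then contracting their edge loses at most
    c./2 - 1 edges, and induction applies. Otherwise [dense_weight] does. *)
Theorem bridge_weight e D : bridge e D -> 1 < #|D| -> weight e D <= (2 * c./2).-1 * #|D|.
Proof.
have [n] := ubnP #|D|; elim: n e D => // n IH e D; rewrite ltnS => Dn brD D2.
have [/(bridge2_weight brD)//|D3] := eqVneq #|D| 2.
have [s [es s2 smax]] := longest_ear brD D2.
pose sparse x y := (#|common e D x y| + #|common e C x y|).+1 < c./2.
case: (consecutive_or sparse s) => [[s1 [x [y [s3 [def_s sp]]]]]|dense]; last first.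
  apply: (dense_weight brD es smax s2) => s1 x y s3 /dense.
  by rewrite /sparse -leqNgt.
have sD := ear_sub es.
have xD : x \in D by apply: sD; rewrite def_s mem_cat !inE eqxx !orbT.
have yD : y \in D by apply: sD; rewrite def_s mem_cat !inE eqxx !orbT.
have xy : e x y.
  have [_ _ [a [b [_ _ _ ps]]]] := earP _ _ _ es.
  by move: ps; rewrite def_s rcons_cat cat_path /= => /and4P[].
have cD := cardsD1 y D; rewrite yD in cD.
have brD' := bridge_contract brD xD yD xy (ear_contractible brD es smax def_s).
have cDy : #|D :\ y| = #|D|.-1 by rewrite cD.
have := IH _ _ _ brD'; rewrite (weight_contract brD xD yD xy) cDy.
move: sp Dn D2 D3; rewrite /sparse; clear.
move: (weight _ _) => w; case: #|D| => // k sp kn k1 k2 /= h.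
have {}h : w <= (2 * c./2).-1 * k by apply: h; lia.
by move: sp h; rewrite mulnS; clear; lia.
Qed.
End Bridge.

(** * The components outside a longest cycle *)

Section LongestCycle.
Variables (T : finType) (e : rel T) (Cs : seq T).
Hypotheses (sym : symmetric e) (irr : irreflexive e).
Hypotheses (cyc : cycle e Cs) (uniqC : uniq Cs) (C3 : 2 < size Cs).
Hypothesis longest : forall s, cycle e s -> uniq s -> size s <= size Cs.
Hypothesis biconn : forall w u v, u != w -> v != w -> connect (inside e [set~ w]) u v.

Notation c := (size Cs).
Notation C := [set x in Cs].
Notation pos := (index^~ Cs).

Lemma card_cycle : #|C| = c.
Proof. by rewrite cardsE; apply/card_uniqP. Qed.

(** Either arc of the cycle could be replaced by the path. *)
Lemma chord_far_lt a b s : a \in Cs -> b \in Cs -> pos a < pos b -> uniq s ->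
  {in s, forall x, x \notin Cs} -> path e a (rcons s b) ->
  (size s < pos b - pos a) && (size s + (pos b - pos a) < c).
Proof.
move=> aC bC; move: cyc uniqC longest.
case/splitPr: aC bC => l1 l2' bC cy un lo.
have al1 : a \notin l1.
  by move: un; rewrite uniq_catC /= mem_cat negb_or => /andP[/andP[]].
have pa : index a (l1 ++ a :: l2') = size l1.
  by rewrite index_cat (negbTE al1) /= eqxx addn0.
rewrite pa => ab us sC ps.
have bl2 : b \in l2'.
  move: bC ab; rewrite mem_cat inE index_cat; case: ifP => bl1 /=.
    by move=> _ /ltnW; rewrite leqNgt index_mem bl1.
  by rewrite eq_sym; case: eqP => //= _; rewrite addn0 ltnn.
case/splitPr: bl2 un cy lo sC pa ab {bC} => l2 l3 un cy lo sC pa ab.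
have bnot : b \notin l1 ++ a :: l2.
  move: un; rewrite -cat_cons catA cat_uniq => /and3P[_ h _].
  by apply: contra h => h; apply/hasP; exists b; rewrite ?mem_head.
have pb : index b (l1 ++ a :: l2 ++ b :: l3) = size l1 + (size l2).+1.
  by rewrite -cat_cons catA index_cat (negbTE bnot) /= eqxx addn0 size_cat.
have cy' : cycle e (a :: l2 ++ b :: l3 ++ l1).
  by move: cy; rewrite -(rot_cycle (size l1)) rot_size_cat /= -catA.
have un' : uniq (a :: l2 ++ b :: l3 ++ l1).
  by move: un; rewrite uniq_catC /= -catA.
move: cy'; rewrite /= rcons_cat cat_path /= => /and3P[p1 lb p3].
have sC' x : x \in s -> x \notin a :: l2 ++ b :: l3 ++ l1.
  move=> /sC; apply: contra; rewrite !(inE, mem_cat).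
  by do ![case/orP] => ->; rewrite ?orbT.
have sub1 : subseq (a :: b :: l3 ++ l1) (a :: l2 ++ b :: l3 ++ l1).
  by rewrite /= eqxx; apply: suffix_subseq.
have sub2 : subseq (a :: rcons l2 b) (a :: l2 ++ b :: l3 ++ l1).
  by rewrite /= eqxx -cat_rcons; apply: prefix_subseq.
have un1 : uniq (a :: s ++ b :: l3 ++ l1).
  rewrite -cat1s uniq_catCA cat1s cat_uniq us (subseq_uniq sub1) // andbT.
  by apply/hasPn=> x /(mem_subseq sub1); apply: contraL => /sC'.
have un2 : uniq (a :: l2 ++ b :: rev s).
  rewrite -cat_rcons -cat_cons cat_uniq rev_uniq us andbT (subseq_uniq sub2) //.
  apply/hasPn=> x; rewrite mem_rev => /sC'; apply: contra.
  exact: (mem_subseq sub2).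
have cy1 : cycle e (a :: s ++ b :: l3 ++ l1).
  move: ps; rewrite /= rcons_cat cat_path rcons_path => /andP[-> /=].
  by move=> ->; rewrite rcons_cat -rcons_cat p3.
have cy2 : cycle e (a :: l2 ++ b :: rev s).
  by rewrite /= rcons_cat cat_path p1 /= lb -path_rev.
have := lo _ cy1 un1; have := lo _ cy2 un2.
rewrite pb !size_cat /= !size_cat /= !size_rev !size_cat; clear; lia.
Qed.

Lemma chord_far a b s : a \in Cs -> b \in Cs -> a != b -> uniq s ->
  {in s, forall x, x \notin Cs} -> path e a (rcons s b) -> far c (size s) (pos a) (pos b).
Proof.
move=> aC bC ab us sC ps.
have ne : pos a != pos b by apply: contraNneq ab => /(index_inj a aC bC) ->.
have [lt|lt] : pos a < pos b \/ pos b < pos a by case: ltngtP ne; [left|right|].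
  have := chord_far_lt aC bC lt us sC ps.
  by rewrite /far; clear -lt; lia.
rewrite path_rev // in ps.
have := @chord_far_lt b a (rev s) bC aC lt; rewrite rev_uniq size_rev => /(_ us _ ps) h.
rewrite /far; have {h} := h _.
have sC' : {in rev s, forall x, x \notin Cs} by move=> x; rewrite mem_rev => /sC.
by move=> /(_ sC'); clear -lt; lia.
Qed.

Definition component z := [set v | connect (inside e (~: C)) z v].

Lemma component_out z : z \notin C -> component z \subset ~: C.
Proof.
move=> zC; apply/subsetP=> v; rewrite inE => zv.
by apply: inside_mem zv _; rewrite inE.
Qed.

Lemma component_closed z : z \notin C ->
  {in component z, forall u v, e u v -> v \notin C -> v \in component z}.
Proof.
move=> zC u uz v uv vC; have := subsetP (component_out zC) _ uz.
move: uz; rewrite !inE => zu uC; apply: connect_trans zu _.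
by apply: connect1; rewrite /inside !inE uC uv; move: vC; rewrite inE => ->.
Qed.

Lemma mem_component z : z \in component z.
Proof. by rewrite inE connect0. Qed.

(** The walk that leads from u to the cycle in G - w stays in the component until it
    reaches the cycle, at a vertex other than w. *)
Lemma component_exit z u w : z \notin C -> u \in component z -> u != w -> exists v b,
  [/\ connect (inside e (component z :\ w)) u v, b \in C, b != w & e v b].
Proof.
move=> zC uz uw.
have [c0 c0C c0w] : exists2 c0, c0 \in Cs & c0 != w.
  case: Cs C3 uniqC => [|a [|b l]] // _ /= /andP[]; rewrite inE negb_or => /andP[ab _] _.
  have [aw|aw] := eqVneq a w; last by exists a; rewrite ?mem_head.
  by exists b; rewrite ?inE ?eqxx ?orbT // -aw eq_sym.
have uC : u \notin C by have := subsetP (component_out zC) _ uz; rewrite in_setC.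
case: (avoid_or_hit (biconn uw c0w) uC) => [h|[v [b [uv /setIP[bw bC] vb]]]].
  have : c0 \in [set~ w] :\: C
    by apply: inside_mem h _; rewrite !inE uw; move: uC; rewrite inE => ->.
  by rewrite !inE c0C.
exists v, b; split=> //; last by move: bw; rewrite !inE.
have closed : {in component z, forall x y, inside e ([set~ w] :\: C) x y -> y \in component z}.
  move=> x xz y /and3P[_ yD xy]; apply: (component_closed zC xz xy).
  by move: yD; rewrite in_setD => /andP[].
apply: (inside_mono _ (connect_within closed uz uv)).
by apply/subsetP=> x; rewrite !inE => /andP[/andP[_ ->] ->].
Qed.

(** The second attachment in [bridge_two] is found by avoiding the first one. *)
Lemma component_bridge z : z \notin C -> bridge C pos c e (component z).
Proof.
move=> zC; have zz := mem_component z.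
have out := component_out zC.
split=> //.
- by rewrite disjoints_subset.
- move=> u v uz vz.
  have uv : connect (inside e (~: C)) u v.
    by move: uz vz; rewrite !inE => zu; apply: connect_trans; rewrite inside_sym.
  have closed : {in component z, forall x y, inside e (~: C) x y -> y \in component z}.
    move=> x xz y /and3P[_ yD xy]; apply: (component_closed zC xz xy).
    by move: yD; rewrite in_setC.
  by apply: (inside_mono _ (connect_within closed uz uv)); apply: subsetIr.
- move=> w u wz uz uw; have [v [b [uv bC _ vb]]] := component_exit zC uz uw.
  by exists v, b.
- have [c0 c0C] : exists c0, c0 \in C.
    by case: Cs C3 => // a l _; exists a; rewrite inE mem_head.
  have zne x : x \in C -> z != x by apply: contraTneq => <-.
  have [u [a [zu aC ac0 ua]]] := component_exit zC zz (zne _ c0C).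
  have [v [b [zv bC ba vb]]] := component_exit zC zz (zne _ aC).
  exists u, v, a, b; rewrite ua vb eq_sym; split=> //.
    have : u \in component z :\ c0 by apply: inside_mem zu _; rewrite in_setD1 zne.
    by rewrite in_setD1 => /andP[].
  have : v \in component z :\ a by apply: inside_mem zv _; rewrite in_setD1 zne.
  by rewrite in_setD1 => /andP[].
- move=> a b s; rewrite !inE => aC bC ab us sz ps; apply: chord_far => //.
  by move=> x /sz /(subsetP out); rewrite !inE.
Qed.

Lemma pos_inj : {in C &, injective pos}.
Proof. by move=> a b; rewrite !inE => aC bC; apply: (index_inj a). Qed.

Lemma pos_lt : {in C, forall a, pos a < c}.
Proof. by move=> a; rewrite inE index_mem. Qed.

Lemma nbrs_half v : v \notin C -> #|nbrs e C v| <= c./2.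
Proof.
move=> vC; have [h|/card_gt1P[a [b [aN bN ab]]]] := leqP #|nbrs e C v| 1.
  by apply: leq_trans h _; move: C3; clear; lia.
move: aN bN; rewrite !in_nbrs => /andP[aC va] /andP[bC vb].
have vv : {subset [:: v] <= component v} by move=> x; rewrite inE => /eqP->; apply: mem_component.
have := ear_ends_bound pos_inj pos_lt (component_bridge vC) (s := [::]) isT vv isT.
by move=> /(_ a b aC bC ab va vb); rewrite /= setUid; clear; lia.
Qed.

(** There are no edges between different components of G - C, so their weights add
    up. *)
Lemma sum_components k :
  (forall z, z \notin C -> weight C e (component z) <= k * #|component z|) ->
  weight C e (~: C) <= k * #|~: C|.
Proof.
move=> hk.
have main n (S : {set T}) : #|S| < n -> S \subset ~: C ->
    {in S, forall u v, e u v -> v \notin C -> v \in S} -> weight C e S <= k * #|S|.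
  elim: n S => // n IH S; rewrite ltnS => Sn SC cl.
  have [->|[z zS]] := set_0Vmem S; first by rewrite /weight /darts !big_set0.
  have zC : z \notin C by have := subsetP SC z zS; rewrite in_setC.
  set D := component z.
  have DS : D \subset S.
    apply/subsetP=> v; rewrite inE => zv.
    have cl' : {in S, forall x y, inside e (~: C) x y -> y \in S}.
      by move=> x xS y /and3P[_ yC xy]; apply: (cl x xS y xy); rewrite -in_setC.
    have := inside_mem (connect_within cl' zS zv).
    by rewrite in_setI in_setC zC zS => /(_ isT)/setIP[].
  have defS : S = D :|: (S :\: D) by rewrite -{1}(setID S D) (setIidPr DS).
  have dj : [disjoint D & S :\: D] by rewrite disjoint_sym disjoints_subset setDE subsetIr.
  have cross : darts e D (S :\: D) = 0.
    apply: darts_eq0 => u v uD; rewrite in_setD => /andP[vD vS]; apply: contra vD => uv.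
    by apply: (component_closed zC uD uv); have := subsetP SC v vS; rewrite in_setC.
  have cardS : #|S| = #|D| + #|S :\: D| by rewrite {1}defS cardsU (disjoint_setI0 dj) cards0 subn0.
  have D0 : 0 < #|D| by apply/card_gt0P; exists z; apply: mem_component.
  have wS : weight C e S = weight C e D + weight C e (S :\: D).
    rewrite /weight {1 2 3}defS !dartsUl // !dartsUr // cross (darts_sym (S :\: D) D sym) cross.
    by clear; lia.
  rewrite wS cardS mulnDr leq_add ?hk // IH //.
  - by move: Sn cardS D0; clear; lia.
  - by apply: subset_trans (subsetDl _ _) SC.
  - move=> u; rewrite in_setD => /andP[uD uS] v uv vC; rewrite in_setD (cl u uS) // andbT.
    apply: contra uD => vD; apply: (component_closed zC vD); first by rewrite sym.
    by have := subsetP SC u uS; rewrite in_setC.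
apply: (main #|~: C|.+1) => // u _ v _; by rewrite in_setC.
Qed.

Lemma component1_weight z : #|component z| = 1 -> weight C e (component z) = 2 * #|nbrs e C z|.
Proof.
move=> c1; have -> : component z = [set z].
  by apply/eqP; rewrite eq_sym eqEcard sub1set mem_component cards1 c1.
by rewrite /weight !darts1l !big_set1 irr card_nbrs.
Qed.

Lemma outside_weight : weight C e (~: C) <= 2 * c./2 * #|~: C|.
Proof.
apply: sum_components => z zC; have [c1|c2] := leqP #|component z| 1.
  have c1' : #|component z| = 1.
    by apply/eqP; rewrite eqn_leq c1; apply/card_gt0P; exists z; apply: mem_component.
  by rewrite component1_weight // c1' muln1 leq_mul2l nbrs_half.
apply: leq_trans (bridge_weight pos_inj pos_lt (component_bridge zC) c2) _.
by rewrite leq_mul2r leq_pred orbT.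
Qed.

(** A component with a single vertex has twice the degree as weight; all others
    satisfy the stronger bound of [bridge_weight] anyway. *)
Lemma outside_weight_lt : (forall v, v \notin C -> #|nbrs e C v| < c./2) ->
  weight C e (~: C) <= (2 * c./2).-1 * #|~: C|.
Proof.
move=> few; apply: sum_components => z zC; have [c1|c2] := leqP #|component z| 1.
  have c1' : #|component z| = 1.
    by apply/eqP; rewrite eqn_leq c1; apply/card_gt0P; exists z; apply: mem_component.
  by rewrite component1_weight // c1' muln1; have := few z zC; clear; lia.
exact: (bridge_weight pos_inj pos_lt (component_bridge zC) c2).
Qed.

End LongestCycle.

(** * A vertex adjacent to every second vertex of a longest cycle *)

Section Successors.
Variables (T : finType) (e : rel T) (Cs : seq T) (v : T).
Hypotheses (sym : symmetric e) (irr : irreflexive e).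
Hypotheses (cyc : cycle e Cs) (uniqC : uniq Cs).
Hypothesis longest : forall s, cycle e s -> uniq s -> size s <= size Cs.
Hypothesis vC : v \notin Cs.

(** Otherwise, with successors a' and b', the cycle through v, b, backwards to a',
    b', forwards to a, would be longer. *)
Lemma succ_nonadj a b : a \in Cs -> b \in Cs -> a != b -> e v a -> e v b ->
  ~~ e (next Cs a) (next Cs b).
Proof.
move=> aC bC ab va vb; apply/negP=> hab.
have [i p1 p2 _ _ rotC] := rot_to_arc uniqC aC bC ab.
have ur : uniq (rot i Cs) by rewrite rot_uniq.
have [h1 [t1 def1]] : exists h1 t1, rcons p1 b = h1 :: t1.
  by case: (p1) => [|h l]; [exists b, [::] | exists h, (rcons l b)].
have [h2 [t2 def2]] : exists h2 t2, rcons p2 a = h2 :: t2.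
  by case: (p2) => [|h l]; [exists a, [::] | exists h, (rcons l a)].
have na : next Cs a = h1.
  rewrite -(next_rot i uniqC) rotC; case: (p1) def1 => [|h l] [<- _] /=;
  by rewrite eqxx.
have nb : next Cs b = h2.
  rewrite -(next_rot i uniqC) -(next_rot (size (a :: p1)) ur) rotC -cat_cons rot_size_cat.
  by case: (p2) def2 => [|h l] [<- _] /=; rewrite eqxx.
have rotC' : rot 1 (rot i Cs) = (h1 :: t1) ++ h2 :: t2.
  by rewrite rotC cat_cons rot1_cons -cat_rcons rcons_cat def1 def2.
have u' : uniq ((h1 :: t1) ++ h2 :: t2) by rewrite -rotC' !rot_uniq.
have cy' : cycle e ((h1 :: t1) ++ h2 :: t2) by rewrite -rotC' !rot_cycle.
have l1 : last h1 t1 = b by rewrite -(last_cons h1) -def1 last_rcons.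
have l2 : last h2 t2 = a by rewrite -(last_cons h2) -def2 last_rcons.
move: cy'; rewrite /= rcons_cat cat_path l1 /= rcons_path l2 => /and3P[pt1 _ /andP[pt2 _]].
have new_cycle : cycle e (v :: rev (h1 :: t1) ++ h2 :: t2).
  rewrite /= rcons_cat rev_cons cat_path last_rcons path_rev // revK /= !rcons_path.
  by rewrite pt1 l1 pt2 l2 -na -nb hab /= sym vb sym va.
have memC x : (x \in (h1 :: t1) ++ h2 :: t2) = (x \in Cs) by rewrite -rotC' !mem_rot.
have new_uniq : uniq (v :: rev (h1 :: t1) ++ h2 :: t2).
  rewrite cons_uniq mem_cat mem_rev -mem_cat memC vC /=.
  by rewrite (perm_uniq (s2 := (h1 :: t1) ++ h2 :: t2)) // perm_cat2r perm_rev.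
have := longest new_cycle new_uniq.
rewrite /= size_cat size_rev -(size_cat (h1 :: t1)) -rotC' !size_rot.
by rewrite ltnn.
Qed.

Lemma succ_nonnbr a : 1 < size Cs -> a \in Cs -> e v a -> ~~ e v (next Cs a).
Proof.
move=> C2 aC va; apply/negP=> vna; have [i s' rotC] := rot_to aC.
have [h [t def_s]] : exists h t, s' = h :: t.
  by move: C2; rewrite -(size_rot i Cs) rotC; case: (s') => // h t _; exists h, t.
move: vna; rewrite -(next_rot i uniqC) rotC def_s /= eqxx => vh.
have ur : uniq (a :: h :: t) by rewrite -def_s -rotC rot_uniq.
have cr : cycle e (a :: h :: t) by rewrite -def_s -rotC rot_cycle.
have memC x : (x \in a :: h :: t) = (x \in Cs) by rewrite -def_s -rotC mem_rot.
have new_cycle : cycle e (v :: h :: rcons t a).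
  move: cr; rewrite /= vh !rcons_path last_rcons => /and3P[_ -> ->].
  by rewrite /= sym.
have new_uniq : uniq (v :: h :: rcons t a).
  rewrite cons_uniq -rcons_cons rcons_uniq mem_rcons.
  move: ur; rewrite cons_uniq => /andP[-> ->]; rewrite andbT.
  by rewrite memC vC.
have := longest new_cycle new_uniq.
by rewrite /= size_rcons -(size_rot i Cs) rotC def_s /= ltnn.
Qed.

End Successors.

(** The successors Sp and the predecessors Sm of the neighbours A of v are independent
    sets in the rest B of the cycle. Since A has the maximal possible size c./2, each
    of them misses at most one vertex of B. *)
Section Alternating.
Variables (T : finType) (e : rel T) (Cs : seq T) (v : T).
Hypotheses (sym : symmetric e) (irr : irreflexive e).
Hypotheses (cyc : cycle e Cs) (uniqC : uniq Cs) (C3 : 2 < size Cs).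
Hypothesis longest : forall s, cycle e s -> uniq s -> size s <= size Cs.
Hypothesis vC : v \notin Cs.

Notation c := (size Cs).
Notation C := [set x in Cs].
Let A := nbrs e C v.
Let B := C :\: A.
Let Sp := [set next Cs a | a in A].
Let Sm := [set prev Cs a | a in A].

Hypothesis cA : #|A| = c./2.

Let inA x : x \in A -> x \in Cs /\ e v x.
Proof. by rewrite in_nbrs inE => /andP[]. Qed.

Let cycR : cycle e (rev Cs).
Proof. by rewrite rev_cycle -(eq_cycle (e := e)) // => x y; rewrite sym. Qed.
Let uniqR : uniq (rev Cs). Proof. by rewrite rev_uniq. Qed.
Let longestR s : cycle e s -> uniq s -> size s <= size (rev Cs).
Proof. by rewrite size_rev; apply: longest. Qed.
Let vR : v \notin rev Cs. Proof. by rewrite mem_rev. Qed.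

Let Sp_sub : Sp \subset B.
Proof.
apply/subsetP=> _ /imsetP[a /inA[aC va] ->].
rewrite in_setD in_nbrs inE mem_next aC /= andbT.
exact: (succ_nonnbr sym cyc uniqC longest vC (ltnW C3) aC va).
Qed.

Let Sm_sub : Sm \subset B.
Proof.
apply/subsetP=> _ /imsetP[a /inA[aC va] ->].
rewrite in_setD in_nbrs inE mem_prev aC /= andbT -next_rev //.
by apply: (succ_nonnbr sym cycR uniqR longestR vR); rewrite ?size_rev ?(ltnW C3) ?mem_rev.
Qed.

Let card_Sp : #|Sp| = c./2.
Proof. by rewrite card_imset //; apply: can_inj (prev_next uniqC). Qed.
Let card_Sm : #|Sm| = c./2.
Proof. by rewrite card_imset //; apply: can_inj (next_prev uniqC). Qed.

Let Sp_free : {in Sp &, forall x y, ~~ e x y}.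
Proof.
move=> _ _ /imsetP[a /inA[aC va] ->] /imsetP[b /inA[bC vb] ->].
have [->|ab] := eqVneq a b; first by rewrite irr.
exact: (succ_nonadj sym cyc uniqC longest vC aC bC ab va vb).
Qed.

Let Sm_free : {in Sm &, forall x y, ~~ e x y}.
Proof.
move=> _ _ /imsetP[a /inA[aC va] ->] /imsetP[b /inA[bC vb] ->].
have [->|ab] := eqVneq a b; first by rewrite irr.
rewrite -!next_rev //.
by apply: (succ_nonadj sym cycR uniqR longestR vR); rewrite ?mem_rev.
Qed.

Let card_B : #|B| = c - c./2.
Proof.
rewrite cardsD (setIidPr _) ?cA ?cardsE; last first.
  by apply/subsetP=> x; rewrite in_nbrs => /andP[].
by rewrite (card_uniqP uniqC).
Qed.

Lemma off_alternating_even : ~~ odd c -> darts e B B = 0.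
Proof.
move=> ev; apply: darts_eq0.
suff -> : B = Sp by apply: Sp_free.
apply/esym/eqP; rewrite eqEcard Sp_sub card_Sp card_B.
by have := odd_double_half c; rewrite (negbTE ev); clear; lia.
Qed.

(** For odd c, an edge in B contains the vertex p missed by Sp and the vertex q missed
    by Sm. These are different, so the edge is pq. *)
Lemma darts_off_alternating : darts e B B <= 2.
Proof.
have [od|/off_alternating_even->//] := boolP (odd c).
have cB : #|B| = (c./2).+1.
  by rewrite card_B; have := odd_double_half c; rewrite od; clear; lia.
have [p Bp] : exists p, B :\: Sp = [set p].
  by apply/cards1P; rewrite cardsD (setIidPr Sp_sub) cB card_Sp subSnn.
have [q Bq] : exists q, B :\: Sm = [set q].
  by apply/cards1P; rewrite cardsD (setIidPr Sm_sub) cB card_Sm subSnn.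
have pB : p \in B :\: Sp by rewrite Bp inE.
have qB : q \in B :\: Sm by rewrite Bq inE.
have not_p x : x \in B -> x != p -> x \in Sp.
  by move=> xB; apply: contraNT => xS; rewrite -in_set1 -Bp in_setD xS.
have not_q x : x \in B -> x != q -> x \in Sm.
  by move=> xB; apply: contraNT => xS; rewrite -in_set1 -Bq in_setD xS.
(* If p = q, then the successor of p is neither in A nor the successor of a vertex
   of A, although p is the only such vertex of B. *)
have pq : p != q.
  apply/eqP=> pq; move: pB qB; rewrite -pq !in_setD => /and3P[pSp pA pC] /andP[pSm _].
  rewrite inE in pC.
  have npA : next Cs p \notin A.
    by apply: contra pSm => npA; rewrite -(prev_next uniqC p); apply: imset_f.
  have npB : next Cs p \in B by rewrite in_setD npA inE mem_next.
  have np : next Cs p != p.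
    by apply: contraTneq (next_cycle cyc pC) => ->; rewrite irr.
  have /imsetP[a aA] := not_p _ npB np.
  by move/(can_inj (prev_next uniqC)) => pa; rewrite pa aA in pA.
have few x : x \in B -> #|nbrs e B x| <= (x == p) + (x == q).
  move=> xB.
  have sub : nbrs e B x \subset (if x == p then [set q] else if x == q then [set p] else set0).
    apply/subsetP=> y; rewrite in_nbrs => /andP[yB xy].
    have h1 : (x == p) || (y == p).
      apply: contraTT xy => /norP[xp yp]; apply: Sp_free; exact: not_p.
    have h2 : (x == q) || (y == q).
      apply: contraTT xy => /norP[xp yp]; apply: Sm_free; exact: not_q.
    have [xp|xp] := eqVneq x p.
      by move: h2; rewrite xp (negbTE pq) inE.
    move: h1 h2; rewrite (negbTE xp) /=; case: (eqVneq x q) => [_ yp _|_ /eqP yp /eqP yq].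
      by rewrite inE.
    by move: pq; rewrite -yp -yq eqxx.
  apply: leq_trans (subset_leq_card sub) _.
  by case: (x == p); rewrite ?cards1 //; case: (x == q); rewrite ?cards1 ?cards0.
have one (z : T) : \sum_(x in B) (x == z : nat) <= 1.
  have [zB|zB] := boolP (z \in B).
    by rewrite (bigD1 z) //= eqxx big1 // => x /andP[_ /negbTE->].
  by rewrite big1 // => x xB; case: eqP zB => // <-; rewrite xB.
have le : \sum_(x in B) #|nbrs e B x| <= \sum_(x in B) ((x == p) + (x == q)).
  by apply: leq_sum => x; apply: few.
by rewrite dartsE (leq_trans le) // big_split; apply: (leq_add (one p) (one q)).
Qed.

End Alternating.

(** * The bound around a longest cycle *)

(** The loss of one edge per outside vertex pays for a complete graph on the cycle. *)
Lemma short_cycle_arith t tau a w m : tau < t -> a <= 2 * tau + 1 ->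
  t ^ 2 <= a + m -> w <= 2 * tau * m ->
  forall d, d <= a * a.-1 -> d + w <= 2 * (t * (a + m - t)).
Proof.
move=> ltt alo big hw d hd.
have h1 : a * a.-1 <= 2 * tau * a by rewrite mulnC leq_mul2r; lia.
have h2 : d + w <= 2 * tau * (a + m) by rewrite mulnDr leq_add // (leq_trans hd).
apply: leq_trans h2 _; nia.
Qed.

(** Likewise for the loss of half an edge per outside vertex. Here the hypothesis on
    the order a + m of the graph is what k ^ 2 <= 2 n gives, for k > a. *)
Lemma sparse_arith t a w m : a = 2 * t \/ a = 2 * t + 1 -> 0 < t ->
  2 * t ^ 2 + (2 * t + 1) * (a - 2 * t) <= a + m -> w <= (2 * t).-1 * m ->
  forall d, d <= a * a.-1 -> d + w <= 2 * (t * (a + m - t)).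
Proof.
move=> ha t0 big hw d hd.
have -> : t * (a + m - t) = t * (a - t) + t * m by rewrite -mulnDr; congr (_ * _); lia.
have h : d + w + m <= a * a.-1 + 2 * t * m by nia.
case: ha => ha; subst a; nia.
Qed.

Section UpperBound.
Variables (T : finType) (e : rel T) (Cs : seq T).
Hypotheses (sym : symmetric e) (irr : irreflexive e).
Hypotheses (cyc : cycle e Cs) (uniqC : uniq Cs) (C3 : 2 < size Cs).
Hypothesis longest : forall s, cycle e s -> uniq s -> size s <= size Cs.
Hypothesis biconn : forall w u v, u != w -> v != w -> connect (inside e [set~ w]) u v.

Notation c := (size Cs).
Notation C := [set x in Cs].

Lemma darts_split (S : {set T}) :
  darts e setT setT = darts e S S + weight S e (~: S).
Proof.
have d : [disjoint S & ~: S] by rewrite disjoints_subset setCK.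
rewrite -(setUCr S) dartsUl // !dartsUr // (darts_sym S (~: S) sym) /weight.
by clear; lia.
Qed.

Variables k r : nat.
Let t := (k - 1) %/ 2.
Hypotheses (k5 : 5 <= k) (r3 : 3 <= r) (rt : r <= t + 1).
Hypotheses (big : k ^ 2 <= 2 * #|T|) (ck : c < k).
Hypothesis clique_free : forall Q : {set T}, clique e Q -> #|Q| != r.

(** Since v is adjacent to all of A, there is no K_(r-1) in A. If the rest B of the
    cycle contains an edge xy, then either some pair in A x B is not adjacent, or
    x and y are adjacent to all of A. In the latter case A has no K_(r-2), and
    [turan_lt] gains the missing edge. *)
Lemma alternating_bound v : v \notin C -> #|nbrs e C v| = c./2 -> c./2 = t ->
  darts e setT setT <= 2 * (turan_number t (r - 2) + t * (#|T| - t)).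
Proof.
move=> vC cA ct; set A := nbrs e C v in cA; pose B := C :\: A.
have vC' : v \notin Cs by rewrite inE in vC.
have AC : A \subset C by apply/subsetP=> x; rewrite in_nbrs => /andP[].
have cA' : #|A| = t by rewrite cA.
have cB : #|B| = c - t by rewrite cardsD (setIidPr AC) cA' card_cycle.
have defC : C = A :|: B by rewrite -[LHS](setID _ A) (setIidPr AC).
have dAB : [disjoint A & B] by rewrite disjoint_sym disjoints_subset /B setDE subsetIr.
have dC : darts e C C = darts e A A + 2 * darts e A B + darts e B B.
  by rewrite {1 2}defC dartsUl // !dartsUr // (darts_sym B A sym); clear; lia.
have vA : {in A, forall u, e v u} by move=> u; rewrite in_nbrs => /andP[].
have notA x (Q : {set T}) : Q \subset A -> x \notin C -> x \notin Q.
  by move=> /subsetP sQ; apply: contra => /sQ; apply: (subsetP AC).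
have tfree (Q : {set T}) : Q \subset A -> clique e Q -> #|Q| != (r - 2).+1.
  move=> sQ cQ; have vQ : {in Q, forall u, e v u} by move=> u uQ; apply/vA/(subsetP sQ).
  have := clique_free (clique_setU1 sym cQ vQ).
  by rewrite cardsU1 (notA v Q sQ vC); move: r3; clear; lia.
have hAA := turan sym irr (_ : 0 < r - 2) tfree.
have {}hAA : darts e A A <= 2 * turan_number t (r - 2).
  by rewrite -cA'; apply: hAA; move: r3; clear; lia.
have hAB : darts e A B <= t * (c - t) by have := darts_le e A B; rewrite cA' cB.
have hBB : darts e B B <= 2 := darts_off_alternating sym irr cyc uniqC C3 longest vC' cA.
have key : darts e C C <= 2 * turan_number t (r - 2) + 2 * (t * (c - t)).
  rewrite dC.
  have [/exists_inP[x xB /exists_inP[y yB xy]]|none] := boolP [exists x in B, exists y in B, e x y];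
    last first.
    suff -> : darts e B B = 0 by move: hAA hAB; clear; lia.
    apply: darts_eq0 => x y xB yB; apply: contra none => xy.
    by apply/exists_inP; exists x => //; apply/exists_inP; exists y.
  have [/existsP[a /existsP[u /and3P[aA uB nau]]]|full] :=
    boolP [exists a, exists u, [&& a \in A, u \in B & ~~ e a u]].
    have := darts_missing aA uB nau; rewrite cA' cB.
    by move: hAA hAB hBB; clear; lia.
  have {}full u : u \in B -> {in A, forall a, e u a}.
    move=> uB a aA; apply: contraNT full => nau.
    by apply/existsP; exists a; apply/existsP; exists u; rewrite aA uB sym.
  have BnotA z (Q : {set T}) : Q \subset A -> z \in B -> z \notin Q.
    by move=> /subsetP sQ; rewrite in_setD => /andP[zA _]; apply: contra zA; apply: sQ.
  have ufree (Q : {set T}) : Q \subset A -> clique e Q -> #|Q| != r - 2.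
    move=> sQ cQ; have cyQ : clique e (y |: Q).
      by apply: clique_setU1 => // u uQ; apply: full => //; apply: (subsetP sQ).
    have cxyQ : clique e (x |: (y |: Q)).
      apply: clique_setU1 => // u; rewrite !inE => /predU1P[->//|uQ].
      by apply: full => //; apply: (subsetP sQ).
    have := clique_free cxyQ; rewrite !cardsU1 (BnotA y Q sQ yB) !inE.
    rewrite (negbTE (BnotA x Q sQ xB)) orbF.
    have -> : x != y by apply: contraTneq xy => ->; rewrite irr.
    by move: r3; clear; lia.
  have := turan_lt sym irr _ ufree; rewrite cA' => h.
  have : darts e A A + 2 <= 2 * turan_number t (r - 2).
    by apply: h; move: r3 rt; clear; lia.
  by move: hAB hBB; clear; lia.
rewrite (darts_split C).
have := outside_weight sym irr cyc uniqC C3 longest biconn.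
have cT : #|~: C| = #|T| - c by rewrite -(cardsC C) card_cycle // addKn.
have cle : c <= #|T| by rewrite -card_cycle // max_card.
have tc : t <= c by rewrite -ct; clear; lia.
rewrite cT ct => hw; apply: leq_trans (leq_add key hw) _.
have -> : #|T| - t = (c - t) + (#|T| - c) by move: cle tc; clear; lia.
by rewrite !mulnDr -mulnA; clear; lia.
Qed.

Theorem longest_cycle_bound :
  darts e setT setT <= 2 * (turan_number t (r - 2) + t * (#|T| - t)).
Proof.
have cT : #|~: C| = #|T| - c by rewrite -(cardsC C) card_cycle // addKn.
have cle : c <= #|T| by rewrite -card_cycle // max_card.
have hC : darts e C C <= c * c.-1 by rewrite -card_cycle //; apply: darts_irr_le.
have hw := outside_weight sym irr cyc uniqC C3 longest biconn.
have kt : 2 * t + 1 <= k /\ k <= 2 * t + 2.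
  by move: k5; rewrite /t; clear; lia.
have ct : c./2 <= t by move: ck kt; clear; lia.
have Tsplit : #|T| = c + (#|T| - c) by move: cle; clear; lia.
suff h : c./2 < t \/ (c./2 = t /\ forall v, v \notin C -> #|nbrs e C v| < c./2) ->
    darts e setT setT <= 2 * (turan_number t (r - 2) + t * (#|T| - t)).
  have [lt|ge] := ltnP c./2 t; first by apply: h; left.
  have ctE : c./2 = t by apply/eqP; rewrite eqn_leq ct.
  have [/existsP[v /andP[vC]]|none] := boolP [exists v, (v \notin C) && (c./2 <= #|nbrs e C v|)].
    move=> many; apply: (@alternating_bound v) => //.
    by apply/eqP; rewrite eqn_leq many nbrs_half.
  apply: h; right; split=> // v vC; rewrite ltnNge; apply: contra none => many.
  by apply/existsP; exists v; rewrite vC.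
move=> cases; rewrite (darts_split C).
suff : darts e C C + weight C e (~: C) <= 2 * (t * (c + (#|T| - c) - t)).
  by rewrite -Tsplit; clear; lia.
rewrite cT in hw.
case: cases => [lt|[ctE few]].
  apply: (short_cycle_arith (tau := c./2)) hC => //.
  - by clear; lia.
  - by rewrite -Tsplit; move: big (proj1 kt); clear; nia.
have := outside_weight_lt sym irr cyc uniqC C3 longest biconn few.
rewrite cT ctE => hw'; apply: (sparse_arith _ _ _ hw' hC).
- by move: ctE; clear; lia.
- by move: kt k5; clear; lia.
rewrite -Tsplit.
have [cE|cE] : c = 2 * t \/ c = 2 * t + 1 by move: ctE; clear; lia.
  rewrite cE.
  have := leq_mul (proj1 kt) (proj1 kt); rewrite subnn.
  by move: big; rewrite -!mulnn; move: t (k * k) => u w; clear; lia.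
have k2 : 2 * t + 2 <= k by move: cE ck; clear; lia.
rewrite cE.
have := leq_mul k2 k2; rewrite addKn.
by move: big; rewrite -!mulnn; move: t (k * k) => u w; clear; lia.
Qed.

End UpperBound.

(** * From contained graphs to sequences and sets *)

Lemma first_step (T : finType) (r : rel T) x y :
  connect r x y -> x != y -> exists z, r x z.
Proof.
case/connectP=> [[|z q]] /=; first by move=> _ ->; rewrite eqxx.
by case/andP=> xz _ _ _; exists z.
Qed.

(** A vertex x has two neighbours: the second one is found by avoiding the first. They
    are joined by a path that avoids x. *)
Lemma biconnected_cycle (T : finType) (e : rel T) : symmetric e -> irreflexive e ->
  (forall w u v, u != w -> v != w -> connect (inside e [set~ w]) u v) ->
  2 < #|T| -> exists s, [/\ cycle e s, uniq s & 2 < size s].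
Proof.
move=> sym irr biconn T3.
have /card_gt2P[x [w [y [_ [xw wy yx]]]]] := T3.
have wy' : y != w by rewrite eq_sym.
have xy : x != y by rewrite eq_sym.
have [y1 /and3P[_ _ xy1]] := first_step (biconn w x y xw wy') xy.
have y1x : y1 != x by apply: contraTneq xy1 => ->; rewrite irr.
have [z xz zy1] : exists2 z, x != z & z != y1.
  by have [wy1|] := eqVneq w y1; [exists y; rewrite -?wy1|exists w].
have xy1' : x != y1 by rewrite eq_sym.
have [y2 /and3P[_ y2y1 xy2]] := first_step (biconn y1 x z xy1' zy1) xz.
have y2x : y2 != x by apply: contraTneq xy2 => ->; rewrite irr.
have y1x' : y1 \in [set~ x] by rewrite !inE.
have [q [pq uq lq qx]] := inside_path (biconn x y1 y2 y1x y2x) y1x'.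
exists (x :: y1 :: q); split.
- by rewrite /= xy1 rcons_path pq lq sym.
- by rewrite cons_uniq uq andbT; apply/negP=> /qx; rewrite !inE eqxx.
- case: q lq {pq uq qx} => //= y12; move: y2y1.
  by rewrite -y12 !inE eqxx.
Qed.

Lemma contains_clique (G : sgraph) (Q : {set G}) :
  clique (@adj G) Q -> contains G (complete_graph #|Q|).
Proof.
move=> cQ; exists (fun i : 'I_#|Q| => enum_val i) => [|i j]; first exact: enum_val_inj.
by rewrite /= /complete_adj => ij; apply: cQ; rewrite ?enum_valP // (inj_eq enum_val_inj).
Qed.

Lemma cycle_nth (T : eqType) (e : rel T) (x0 : T) s i : cycle e s -> i < size s ->
  e (nth x0 s i) (nth x0 s (i.+1 %% size s)).
Proof.
case: s => // x p /= /(pathP x0) h; rewrite ltnS => ip.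
have := h i; rewrite size_rcons ltnS => /(_ ip).
have -> : nth x0 (x :: rcons p x) i = nth x0 (x :: p) i.
  by rewrite -rcons_cons nth_rcons /= ltnS ip.
rewrite nth_rcons; case: (ltngtP i (size p)) ip => // [lt _|-> _].
  by rewrite modn_small.
by rewrite modnn.
Qed.

Lemma contains_cycle (G : sgraph) (s : seq G) : cycle (@adj G) s -> uniq s ->
  contains G (cycle_graph (size s)).
Proof.
case: s => [|x p] cy us; first by exists (fun i : 'I_0 => False_rect G (notF (ltn_ord i))) => -[].
pose s := x :: p; exists (fun i : 'I_(size s) => nth x s i).
  by move=> i j /eqP; rewrite nth_uniq // => /eqP /val_inj.
move=> i j /= /andP[_ /orP[] /eqP h]; rewrite -/s.
  by rewrite h; apply: cycle_nth.
by rewrite adj_sym h; apply: cycle_nth.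
Qed.

Section Biconnected.
Variable G : sgraph.
Hypothesis conn2 : vertex_connected 2 G.

Lemma vertex_connected2_inside (w u v : G) :
  u != w -> v != w -> connect (inside (@adj G) [set~ w]) u v.
Proof.
move=> uw vw; have [_ /(_ [set w])] := conn2; rewrite cards1 => /(_ isT)[_ conn].
have uX : u \in ~: [set w] by rewrite !inE.
have vX : v \in ~: [set w] by rewrite !inE.
have := conn (Sub u uX) (Sub v vX).
move/(@connect_hom _ _ _ (inside (@adj G) [set~ w]) val) => -> // a b ab.
by apply: connect1; rewrite /inside !(valP a) !(valP b).
Qed.

End Biconnected.

Lemma exists_longest_cycle (T : finType) (e : rel T) s0 : cycle e s0 -> uniq s0 ->
  exists s, [/\ cycle e s, uniq s, size s0 <= size s &
    forall s', cycle e s' -> uniq s' -> size s' <= size s].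
Proof.
move=> cy0 u0; pose P n := [exists s : n.-tuple T, cycle e s && uniq s].
have PE s : cycle e s -> uniq s -> P (size s).
  by move=> cy us; apply/existsP; exists (in_tuple s); rewrite cy us.
have bound n : P n -> n <= #|T|.
  by case/existsP=> s /andP[_ /card_uniqP us]; rewrite -(size_tuple s) -us max_card.
have exP : exists n, P n by exists (size s0); apply: PE.
have [m /existsP[s /andP[cy us]] mx] := ex_maxnP exP bound.
by exists s; rewrite !size_tuple; split=> // [|s' cy' us']; apply/mx/PE.
Qed.

Lemma upper_bound k r (G : sgraph) : 5 <= k -> 3 <= r ->
  r <= (k - 1) %/ 2 + 1 -> k ^ 2 <= 2 * #|G| -> vertex_connected 2 G ->
  graph_free (clique_or_long_cycle r k) G ->
  num_edges G <= turan_number ((k - 1) %/ 2) (r - 2)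
                 + (k - 1) %/ 2 * (#|G| - (k - 1) %/ 2).
Proof.
move=> k5 r3 rk big conn2 free.
have sym := @adj_sym G; have irr := @adj_irrefl G.
have biconn := @vertex_connected2_inside G conn2.
have [s0 [cy0 u0 s03]] := biconnected_cycle sym irr biconn (proj1 conn2).
have [s [cy us s3 longest]] := exists_longest_cycle cy0 u0.
have {}s3 := leq_trans s03 s3.
have sk : size s < k.
  rewrite ltnNge; apply/negP=> ks.
  by apply: (free (cycle_graph (size s))) (contains_cycle cy us); right; exists (size s).
have kfree (Q : {set G}) : clique (@adj G) Q -> #|Q| != r.
  move=> cQ; apply/eqP=> Qr; apply: (free (complete_graph #|Q|)) (contains_clique cQ).
  by left; rewrite Qr.
have := longest_cycle_bound sym irr cy us s3 longest biconn k5 r3 rk big sk kfree.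
by rewrite -num_edges_darts leq_mul2l.
Qed.

(** * The extremal graph *)

Section Extremal.
Variables t s m : nat.
Notation H := (graph_join (turan_graph t s) (edgeless_graph m)).

Lemma card_join : #|H| = t + m.
Proof. by rewrite card_sum !card_ord. Qed.

Lemma join_edges : 0 < s -> num_edges H = turan_number t s + t * m.
Proof.
move=> s0; apply/eqP; rewrite -(eqn_pmul2l (_ : 0 < 2)) // num_edges_darts.
have e0 (T : finType) (F : T -> nat) : \sum_(u in [set: T]) F u = \sum_u F u.
  by apply: eq_bigl => u; rewrite inE.
rewrite /darts e0 big_sumType /=.
under eq_bigr do rewrite e0 big_sumType /=.
under [X in _ + X]eq_bigr do rewrite e0 big_sumType /=.
rewrite !big_split /= !sum_nat_const !card_ord /=.
have := turan_darts t s0; rewrite /darts e0.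
under eq_bigr do rewrite e0.
by move=> ->; apply/eqP; clear; lia.
Qed.

(** After the deletion of one vertex both sides of the join are nonempty. *)
Lemma join_biconnected : 1 < t -> 1 < m -> vertex_connected 2 H.
Proof.
move=> t2 m2; split; first by rewrite card_join; move: t2 m2; clear; lia.
move=> X X1.
have avoid (u v : H) : u != v -> exists2 w, w \notin X & (w == u) || (w == v).
  move=> uv; have [uX|uX] := boolP (u \in X); last by exists u; rewrite ?eqxx.
  exists v; rewrite ?eqxx ?orbT //; apply: contraTN X1 => vX; rewrite -leqNgt.
  have <- : #|[set u; v]| = 2 by rewrite cards2 uv.
  by apply: subset_leq_card; apply/subsetP=> w; rewrite !inE => /orP[] /eqP->.
have [a aX] : exists a, inl a \notin X.
  have /avoid[w wX] : inl (Ordinal (ltnW t2)) != inl (Ordinal t2) :> H by [].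
  by case/orP=> /eqP wE; rewrite wE in wX; eexists; apply: wX.
have [b bX] : exists b, inr b \notin X.
  have /avoid[w wX] : inr (Ordinal (ltnW m2)) != inr (Ordinal m2) :> H by [].
  by case/orP=> /eqP wE; rewrite wE in wX; eexists; apply: wX.
have aX' : inl a \in ~: X by rewrite inE.
have bX' : inr b \in ~: X by rewrite inE.
pose a0 : induced (~: X) := exist _ (inl a : H) aX'.
pose b0 : induced (~: X) := exist _ (inr b : H) bX'.
have toa x : connect (@adj (induced (~: X))) x a0.
  case: x => [[i|j] xX]; last by apply: connect1.
  apply: (@connect_trans _ _ b0); exact: connect1.
split; first by apply/card_gt0P; exists a0.
move=> x y; apply: connect_trans (toa x) _.
by rewrite (sym_connect_sym (@adj_sym _)).
Qed.

(** A clique takes at most one vertex from each of the s residue classes and at most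
    one from the edgeless side. *)
Lemma join_clique_free r : 0 < s -> s + 1 < r -> ~ contains H (complete_graph r).
Proof.
move=> s0 sr [f finj fadj].
pose g (i : 'I_r) : option 'I_s := match f i with
  | inl x => Some (Ordinal (ltn_pmod x s0)) | inr _ => None end.
have ginj : injective g.
  move=> i j; rewrite /g => gij; apply/eqP; apply: contraT => /fadj.
  case: (f i) (f j) gij => [x|x] [y|y] //= [xy].
  by rewrite /turan_adj xy eqxx.
have := leq_card g ginj; rewrite card_option !card_ord.
by move: sr; clear; lia.
Qed.

(** The successor of a cycle vertex on the edgeless side is on the other side. So at
    least half of the cycle is among the t vertices of the Turán graph. *)
Lemma join_cycle_free l : 2 * t < l -> 1 < l -> ~ contains H (cycle_graph l).
Proof.
move=> tl l2 [f finj fadj].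
pose P := [set i : 'I_l | if f i is inl _ then true else false].
have cP : #|P| <= t.
  have ct : #|[set (inl x : H) | x in [set: 'I_t]]| = t.
    by rewrite card_imset ?cardsT ?card_ord // => x y [].
  rewrite -(card_imset _ finj); apply: leq_trans (eq_leq ct).
  apply: subset_leq_card; apply/subsetP=> _ /imsetP[i iP ->].
  by move: iP; rewrite inE; case: (f i) => // x _; apply: imset_f.
have cC : #|~: P| <= #|P|.
  rewrite -(card_imset _ (@ordS_inj l)); apply: subset_leq_card.
  apply/subsetP=> _ /imsetP[i iP ->].
  have : adj (f i) (f (ordS i)).
    apply: fadj; rewrite /= /cycle_adj eqxx andbT.
    apply/eqP=> /(congr1 val) /= h; have := ltn_ord i; rewrite leq_eqVlt => /orP[/eqP il|il].
      by move: h; rewrite il modnn => h; rewrite h in il; rewrite -il in l2.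
    by move: h; rewrite modn_small // => /n_Sn.
  by move: iP; rewrite !inE; case: (f i) => // x _; case: (f (ordS i)).
by have := cardsC P; rewrite card_ord; move: cP cC tl; clear; lia.
Qed.

End Extremal.

Theorem theorem8 (k r n : nat)
    (hk : 5 <= k) (hkn : k <= n)
    (hr3 : 3 <= r) (hrk : r <= (k - 1) %/ 2 + 1)
    (hn : k ^ 2 <= 2 * n) :
  is_ex_2conn n (clique_or_long_cycle r k)
    (num_edges (G2 k r n)).
Proof.
have tk : 2 * ((k - 1) %/ 2) < k /\ 1 < (k - 1) %/ 2 by move: hk; clear; lia.
have s0 : 0 < r - 2 by move: hr3; clear; lia.
split.
  exists (G2 k r n) => //; split.
  - by rewrite card_join; move: hkn tk; clear; lia.
  - by apply: join_biconnected; move: hkn tk hk; clear; lia.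
  move=> F [->|[l [l3 kl ->]]].
    by apply: join_clique_free => //; move: hr3; clear; lia.
  by apply: join_cycle_free; move: kl l3 tk; clear; lia.
move=> G [cG conn2 free]; rewrite /G2 join_edges // -cG.
by apply: upper_bound; rewrite ?cG.
Qed.
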